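(* Let $R$ and $S$ be rings, $M$ an $R$-$S$-bimodule, $\Lambda=\begin{pmatrix}R&M\\ 0&S\end{pmatrix}$ the formal triangular matrix ring, $n\geqslant 1$ an integer, $\mathcal{X},\mathcal{M}$ classes of left $R$-modules and $\mathcal{Y},\mathcal{N}$ classes of left $S$-modules. (1) Assume that $\left(\begin{pmatrix}\mathcal{X}\\ \mathcal{Y}\end{pmatrix},\mathfrak{D}_{\mathcal{N}}^{\mathcal{M}}\right)$ is a left $n$-cotorsion pair in $\Lambda$-$\mathrm{Mod}$. (a) If $\mathrm{Ext}_R^j(M,\mathcal{M})=0$ for each $1\leqslant j\leqslant n$, then $(\mathcal{X},\mathcal{M})$ is a left $n$-cotorsion pair in $R$-$\mathrm{Mod}$. (b) If $\mathrm{Ext}_R^j(M,\mathcal{M})=0$ for each $1\leqslant j\leqslant n$, $\mathrm{Hom}_R(M,\mathcal{X})\subseteq\mathcal{N}_{n-1}^{\wedge}$, and $\mathcal{N}_{n-1}^{\wedge}$ is closed under extensions, then $(\mathcal{Y},\mathcal{N})$ is a left $n$-cotorsion pair in $S$-$\mathrm{Mod}$. (2) Assume that $\left(\mathfrak{B}_{\mathcal{Y}}^{\mathcal{X}},\begin{pmatrix}\mathcal{M}\\ \mathcal{N}\end{pmatrix}\right)$ is a right $n$-cotorsion pair in $\Lambda$-$\mathrm{Mod}$. (a) If $\mathrm{Tor}_j^S(M,\mathcal{Y})=0$ for each $1\leqslant j\leqslant n$, then $(\mathcal{Y},\mathcal{N})$ is a right $n$-cotorsion pair in $S$-$\mathrm{Mod}$.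 (b) If $\mathrm{Tor}_j^S(M,\mathcal{Y})=0$ for each $1\leqslant j\leqslant n$, $M\otimes_S\mathcal{N}\subseteq\mathcal{X}_{n-1}^{\vee}$, and $\mathcal{X}_{n-1}^{\vee}$ is closed under extensions, then $(\mathcal{X},\mathcal{M})$ is a right $n$-cotorsion pair in $R$-$\mathrm{Mod}$.
   Context: Rings are associative with identity, modules are unitary, and $S$-$\mathrm{Mod}$ is the category of left $S$-modules. Classes of modules contain $0$ and are closed under isomorphisms. Vanishing and inclusion statements with classes as arguments are meant for all members of the classes. A left $\Lambda$-module is identified with a triple $\begin{pmatrix}X\\ Y\end{pmatrix}_{\varphi}$, where $X\in R$-$\mathrm{Mod}$, $Y\in S$-$\mathrm{Mod}$ and $\varphi:M\otimes_S Y\to X$ is $R$-linear; morphisms to $\begin{pmatrix}X_1\\ Y_1\end{pmatrix}_{\varphi_1}$ are pairs $(f:X\to X_1,\,g:Y\to Y_1)$ with $\varphi_1(M\otimes_S g)=f\varphi$. The map $\varphi^M:Y\to\mathrm{Hom}_R(M,X)$ is $\varphi^M(y)(m)=\varphi(m\otimes y)$. $\begin{pmatrix}\mathcal{P}\\ \mathcal{Q}\end{pmatrix}$ is the class of left $\Lambda$-modules with first component in $\mathcal{P}$ and second component in $\mathcal{Q}$. $\mathfrak{B}_{\mathcal{Y}}^{\mathcal{X}}$ is the class of $\begin{pmatrix}X\\ Y\end{pmatrix}_{\varphi}$ with $Y\in\mathcal{Y}$, $\mathrm{Ker}\,\varphi=0$ and $\mathrm{Coker}\,\varphi\in\mathcal{X}$.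 $\mathfrak{D}_{\mathcal{N}}^{\mathcal{M}}$ is the class of $\begin{pmatrix}Z\\ N\end{pmatrix}_{\varphi}$ with $Z\in\mathcal{M}$, $\mathrm{Ker}\,\varphi^M\in\mathcal{N}$ and $\mathrm{Coker}\,\varphi^M=0$. For a class $\mathcal{C}$ of objects of an abelian category and $m\geqslant 0$: $\mathcal{C}_m^{\wedge}$ is the class of objects $A$ admitting an exact sequence $0\to C_k\to\cdots\to C_0\to A\to 0$ with all $C_i\in\mathcal{C}$ and some $k\leqslant m$; $\mathcal{C}_m^{\vee}$ is the class of objects $A$ admitting an exact sequence $0\to A\to C^0\to\cdots\to C^k\to 0$ with all $C^i\in\mathcal{C}$ and some $k\leqslant m$. A pair $(\mathcal{C},\mathcal{D})$ of classes of objects in an abelian category is a left $n$-cotorsion pair if (i) $\mathcal{C}$ is closed under direct summands, (ii) $\mathrm{Ext}^i(C,D)=0$ for all $1\leqslant i\leqslant n$, $C\in\mathcal{C}$, $D\in\mathcal{D}$, and (iii) every object $A$ admits a short exact sequence $0\to K\to C\to A\to 0$ with $C\in\mathcal{C}$, $K\in\mathcal{D}_{n-1}^{\wedge}$. It is a right $n$-cotorsion pair if (i') $\mathcal{D}$ is closed under direct summands, (ii) holds, and (iii') every object $A$ admits a short exact sequence $0\to A\to D\to K\to 0$ with $D\in\mathcal{D}$, $K\in\mathcal{C}_{n-1}^{\vee}$. *)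

(* Defs.v *)
From HB Require Import structures.
From mathcomp Require Import all_boot all_algebra.
From mathcomp Require Import boolp.

Set Implicit Arguments.
Unset Strict Implicit.
Unset Printing Implicit Defensive.

Import GRing.Theory.
Local Open Scope ring_scope.
Local Open Scope quotient_scope.

(** Rings are [pzRingType]s, so that the zero ring is allowed.  The choice
    structure required by [lmodType] is no restriction: the classical axioms of
    [boolp] put one on every type. *)

Definition surj (A B : Type) (f : A -> B) : Prop := forall y, exists x, f x = y.

Definition is_zero (R : pzRingType) (A : lmodType R) : Prop :=
  forall x : A, x = 0.

Definition exact (R : pzRingType) (A B C : lmodType R)
    (f : {linear A -> B}) (g : {linear B -> C}) : Prop :=
  forall y, g y = 0 <-> exists x, f x = y.

Definition short_exact (R : pzRingType) (A B C : lmodType R)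
    (f : {linear A -> B}) (g : {linear B -> C}) : Prop :=
  [/\ injective f, exact f g & surj g].

Definition lmod_iso (R : pzRingType) (A B : lmodType R) : Prop :=
  exists f : {linear A -> B}, bijective f.

Section Kernel.
Variables (R : pzRingType) (A B : lmodType R) (f : {linear A -> B}).

Definition in_ker : {pred A} := fun x => f x == 0.

Fact in_ker_closed : submod_closed in_ker.
Proof.
split=> [|a x y]; rewrite /in_ker /in_mem /= ?linear0 // => /eqP fx /eqP fy.
by rewrite linearP fx fy scaler0 addr0.
Qed.

HB.instance Definition _ := GRing.isSubmodClosed.Build R A in_ker in_ker_closed.

Record kernel := Kernel { kernel_val : A; _ : in_ker kernel_val }.

HB.instance Definition _ := [isSub for kernel_val].
HB.instance Definition _ := [Choice of kernel by <:].
HB.instance Definition _ := [SubChoice_isSubLmodule of kernel by <:].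

End Kernel.

Section Cokernel.
Variables (R : pzRingType) (A B : lmodType R) (f : {linear A -> B}).

Definition in_im : {pred B} := fun y => `[< exists x, f x = y >].

Fact in_im_closed : submod_closed in_im.
Proof.
split=> [|a y z]; first by apply/asboolP; exists 0; rewrite linear0.
move=> /asboolP[x <-] /asboolP[x' <-].
by apply/asboolP; exists (a *: x + x'); rewrite linearP.
Qed.

HB.instance Definition _ := GRing.isSubmodClosed.Build R B in_im in_im_closed.

Definition coker : Type := Quotient.quot in_im.

HB.instance Definition _ := GRing.Zmodule.on coker.
HB.instance Definition _ := EqQuotient.on coker.

Definition coker_proj (y : B) : coker := \pi_(coker) y.

Fact coker_projB : {morph coker_proj : y z / y - z}.
Proof. by move=> y z; rewrite /coker_proj !piE. Qed.

Fact coker_projD : {morph coker_proj : y z / y + z}.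
Proof. by move=> y z; rewrite /coker_proj !piE. Qed.

Fact coker_projP (y z : B) :
  (coker_proj y = coker_proj z) <-> in_im (y - z).
Proof.
rewrite -[in_im _]/(y - z \in in_im) Quotient.idealrBE.
by split=> [|/eqP] //; move/eqP.
Qed.

Definition coker_scale (a : R) (u : coker) : coker := coker_proj (a *: repr u).

Fact coker_scale_proj a y : coker_scale a (coker_proj y) = coker_proj (a *: y).
Proof.
apply/coker_projP; rewrite -scalerBr.
rewrite -[in_im _]/(_ \in in_im) rpredZ //.
by rewrite -[_ \in _]/(in_im _); apply/coker_projP; rewrite /coker_proj reprK.
Qed.

Fact coker_ind (P : coker -> Prop) : (forall y, P (coker_proj y)) -> forall u, P u.
Proof. by move=> Py u; have := Py (repr u); rewrite /coker_proj reprK. Qed.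

Fact coker_scaleA a b u : coker_scale a (coker_scale b u) = coker_scale (a * b) u.
Proof.
by elim/coker_ind: u => y; rewrite !coker_scale_proj scalerA.
Qed.

Fact coker_scale1 : left_id 1 coker_scale.
Proof. by elim/coker_ind=> y; rewrite coker_scale_proj scale1r. Qed.

Fact coker_scaleDr : right_distributive coker_scale +%R.
Proof.
move=> a; elim/coker_ind=> y; elim/coker_ind=> z.
by rewrite -coker_projD !coker_scale_proj -coker_projD scalerDr.
Qed.

Fact coker_scaleDl u : {morph coker_scale^~ u : a b / a + b}.
Proof.
by elim/coker_ind: u => y a b /=; rewrite !coker_scale_proj -coker_projD scalerDl.
Qed.

HB.instance Definition _ := GRing.Zmodule_isLmodule.Build R coker
  coker_scaleA coker_scale1 coker_scaleDr coker_scaleDl.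

Fact coker_proj_linear : linear coker_proj.
Proof.
by move=> a y z; rewrite coker_projD -[coker_proj (a *: y)]coker_scale_proj.
Qed.

HB.instance Definition _ :=
  GRing.isLinear.Build R B coker *:%R coker_proj coker_proj_linear.

End Cokernel.

Record bimodule (R S : pzRingType) := Bimodule {
  bimod_left :> lmodType R;
  rscale : bimod_left -> S -> bimod_left;
  rscaleA : forall m s t, rscale (rscale m s) t = rscale m (s * t);
  rscale1 : forall m, rscale m 1 = m;
  rscaleDl : forall s, {morph rscale^~ s : m m' / m + m'};
  rscaleDr : forall m, {morph rscale m : s t / s + t};
  rscale_scale : forall r m s, rscale (r *: m) s = r *: rscale m s }.

Section HomModule.
Variables (R S : pzRingType) (M : bimodule R S) (X : lmodType R).

(** [Hom_R(M, X)], with the left [S]-action [(s f)(m) = f (m s)] *)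
Definition hom_mod : Type := {linear M -> X}.

HB.instance Definition _ := gen_eqMixin hom_mod.
HB.instance Definition _ := gen_choiceMixin hom_mod.

Definition hom_app (f : hom_mod) : M -> X := (f : {linear M -> X}).

Fact hom_ext (f g : hom_mod) : (forall m, hom_app f m = hom_app g m) -> f = g.
Proof.
move=> fg; have E : (f : M -> X) = (g : M -> X) by apply: funext.
case: f g E {fg} => [f cf] [g cg] /= E; subst g; congr GRing.Linear.Pack.
case: cf cg => [c1 [c2]] [d1 [d2]]; have -> : c2 = d2 by apply: Prop_irrelevance.
congr GRing.Linear.Class; case: c1 d1 => [c1] [d1].
by congr GRing.isNmodMorphism.Axioms_; apply: Prop_irrelevance.
Qed.

Definition hom_zero : hom_mod := \0.
Definition hom_opp (f : hom_mod) : hom_mod := \- (f : {linear M -> X}).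
Definition hom_add (f g : hom_mod) : hom_mod :=
  (f : {linear M -> X}) \+ (g : {linear M -> X}).

Fact hom_addA : associative hom_add.
Proof. by move=> f g h; apply: hom_ext => m; apply: addrA. Qed.

Fact hom_addC : commutative hom_add.
Proof. by move=> f g; apply: hom_ext => m; apply: addrC. Qed.

Fact hom_add0 : left_id hom_zero hom_add.
Proof. by move=> f; apply: hom_ext => m; apply: add0r. Qed.

Fact hom_addN : left_inverse hom_zero hom_opp hom_add.
Proof. by move=> f; apply: hom_ext => m; apply: addNr. Qed.

HB.instance Definition _ :=
  GRing.isZmodule.Build hom_mod hom_addA hom_addC hom_add0 hom_addN.

Definition rmul (s : S) (m : M) : M := rscale m s.

Fact rmul_linear s : linear (rmul s).
Proof. by move=> r m m'; rewrite /rmul rscaleDl rscale_scale. Qed.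

HB.instance Definition _ s := GRing.isLinear.Build R M M *:%R (rmul s) (rmul_linear s).

Definition hom_scale (s : S) (f : hom_mod) : hom_mod :=
  (f : {linear M -> X}) \o rmul s.

Fact hom_scaleA s t f : hom_scale s (hom_scale t f) = hom_scale (s * t) f.
Proof. by apply: hom_ext => m; rewrite /hom_app /= /rmul rscaleA. Qed.

Fact hom_scale1 : left_id 1 hom_scale.
Proof. by move=> f; apply: hom_ext => m; rewrite /hom_app /= /rmul rscale1. Qed.

Fact hom_scaleDr : right_distributive hom_scale +%R.
Proof. by move=> s f g; apply: hom_ext => m. Qed.

Fact hom_scaleDl f : {morph hom_scale^~ f : s t / s + t}.
Proof.
by move=> s t; apply: hom_ext => m; rewrite /hom_app /= /rmul rscaleDr linearD.
Qed.

HB.instance Definition _ := GRing.Zmodule_isLmodule.Build S hom_mod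
  hom_scaleA hom_scale1 hom_scaleDr hom_scaleDl.

End HomModule.

Section Tensor.
Variables (R S : pzRingType) (M : bimodule R S).

(** The list [[:: (m1, y1); ...; (mk, yk)]] stands for the formal sum of the
    [mi (x) yi]; [tens_rel] is the least congruence making the formal sums
    modulo it the abelian group [M (x)_S Y].  Opposites come for free, by
    [tens_DL] and [tens_0]. *)
Inductive tens_rel (Y : lmodType S) : seq (M * Y) -> seq (M * Y) -> Prop :=
| tens_refl l : tens_rel l l
| tens_sym l1 l2 : tens_rel l1 l2 -> tens_rel l2 l1
| tens_trans l1 l2 l3 : tens_rel l1 l2 -> tens_rel l2 l3 -> tens_rel l1 l3
| tens_cat l1 l1' l2 l2' :
    tens_rel l1 l1' -> tens_rel l2 l2' -> tens_rel (l1 ++ l2) (l1' ++ l2')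
| tens_catC l1 l2 : tens_rel (l1 ++ l2) (l2 ++ l1)
| tens_0 y : tens_rel [:: (0, y)] [::]
| tens_DL m m' y : tens_rel [:: (m + m', y)] [:: (m, y); (m', y)]
| tens_DR m y y' : tens_rel [:: (m, y + y')] [:: (m, y); (m, y')]
| tens_S m s y : tens_rel [:: (rscale m s, y)] [:: (m, s *: y)].

Definition pair_map (Y Y' : lmodType S) (h : M -> M) (g : Y -> Y') (p : M * Y) :=
  (h p.1, g p.2).

Fact tens_rel_map (Y Y' : lmodType S) (h : M -> M) (g : {linear Y -> Y'}) l l' :
    h 0 = 0 -> {morph h : m m' / m + m'} ->
    (forall m s, h (rscale m s) = rscale (h m) s) ->
  tens_rel l l' -> tens_rel (map (pair_map h g) l) (map (pair_map h g) l').
Proof.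
move=> h0 hD hS; elim=> {l l'} [l|l1 l2 _|l1 l2 l3 _ IH1 _ IH2|l1 l1' l2 l2' _ IH1 _ IH2|
  l1 l2|y|m m' y|m y y'|m s y]; rewrite ?map_cat /= /pair_map /= ?h0 ?hD ?hS
  ?linearD ?linearZ.
- exact: tens_refl.
- exact: tens_sym.
- exact: tens_trans IH1 IH2.
- exact: tens_cat.
- exact: tens_catC.
- exact: tens_0.
- exact: tens_DL.
- exact: tens_DR.
- exact: tens_S.
Qed.

Section TensorModule.
Variable Y : lmodType S.

Definition tens_eqv (l l' : seq (M * Y)) : bool := `[< tens_rel l l' >].

Fact tens_eqv_equiv : equiv_class_of tens_eqv.
Proof.
split=> [l|l1 l2|l2 l1 l3]; first by apply/asboolP/tens_refl.
  by apply/asboolP/asboolP; apply: tens_sym.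
by move=> /asboolP r12 /asboolP r23; apply/asboolP/(tens_trans r12).
Qed.

Canonical tens_equiv := EquivRelPack tens_eqv_equiv.
Canonical tens_encModRel := defaultEncModRel tens_eqv.

Definition tensor : Type := {eq_quot tens_eqv}.

HB.instance Definition _ := EqQuotient.on tensor.
HB.instance Definition _ := Choice.on tensor.

Definition tmk (l : seq (M * Y)) : tensor := \pi_(tensor) l.

Fact tmkP l l' : tmk l = tmk l' <-> tens_rel l l'.
Proof.
split=> [/eqP|r]; first by rewrite eqquotE => /asboolP.
by apply/eqP; rewrite eqquotE; apply/asboolP.
Qed.

Fact tmk_ind (P : tensor -> Prop) : (forall l, P (tmk l)) -> forall u, P u.
Proof. by move=> Pl u; have := Pl (repr u); rewrite /tmk reprK. Qed.

Fact tmk_repr l : tens_rel (repr (tmk l)) l.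
Proof. by apply/tmkP; rewrite /tmk reprK. Qed.

Definition tens (m : M) (y : Y) : tensor := tmk [:: (m, y)].

Definition tens_zero : tensor := tmk [::].
Definition tens_add (u v : tensor) : tensor := tmk (repr u ++ repr v).
Definition tens_opp (u : tensor) : tensor :=
  tmk (map (pair_map -%R idfun) (repr u)).
Definition tens_scale (r : R) (u : tensor) : tensor :=
  tmk (map (pair_map ( *:%R r) idfun) (repr u)).

Fact tens_add_mk l l' : tens_add (tmk l) (tmk l') = tmk (l ++ l').
Proof. by apply/tmkP/tens_cat; apply: tmk_repr. Qed.

Fact tens_opp_mk l : tens_opp (tmk l) = tmk (map (pair_map -%R idfun) l).
Proof.
apply/tmkP/tens_rel_map/tmk_repr => [|m m'|m s]; first exact: oppr0.
  exact: opprD.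
by apply: (addrI (rscale m s)); rewrite -rscaleDl !subrr -(scale0r 0) rscale_scale !scale0r.
Qed.

Fact tens_scale_mk r l :
  tens_scale r (tmk l) = tmk (map (pair_map ( *:%R r) idfun) l).
Proof.
apply/tmkP/tens_rel_map/tmk_repr => [|m m'|m s]; first exact: scaler0.
  exact: scalerDr.
by rewrite rscale_scale.
Qed.

Fact tens_addA : associative tens_add.
Proof.
elim/tmk_ind=> l1; elim/tmk_ind=> l2; elim/tmk_ind=> l3.
by rewrite !tens_add_mk catA.
Qed.

Fact tens_addC : commutative tens_add.
Proof.
by elim/tmk_ind=> l1; elim/tmk_ind=> l2; rewrite !tens_add_mk; apply/tmkP/tens_catC.
Qed.

Fact tens_add0 : left_id tens_zero tens_add.
Proof. by elim/tmk_ind=> l; rewrite tens_add_mk. Qed.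

Fact tens_addN : left_inverse tens_zero tens_opp tens_add.
Proof.
elim/tmk_ind=> l; rewrite tens_opp_mk tens_add_mk; apply/tmkP.
elim: l => [|[m y] l IH]; first exact: tens_refl.
set N := map _ l in IH *.
rewrite -[map _ _ ++ _]/([:: (- m, y)] ++ (N ++ ([:: (m, y)] ++ l))).
apply: tens_trans (tens_cat (tens_refl _) (tens_catC _ _)) _.
rewrite -catA catA; apply: (tens_trans (l2 := [::] ++ [::])); last exact: tens_refl.
apply: tens_cat; last exact: tens_trans (tens_catC _ _) IH.
by apply: tens_trans (tens_sym (tens_DL _ _ _)) _; rewrite addNr; apply: tens_0.
Qed.

HB.instance Definition _ :=
  GRing.isZmodule.Build tensor tens_addA tens_addC tens_add0 tens_addN.

Fact tens_scaleA r s u : tens_scale r (tens_scale s u) = tens_scale (r * s) u.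
Proof.
elim/tmk_ind: u => l; rewrite !tens_scale_mk -map_comp; congr tmk.
by apply: eq_map => -[m y]; rewrite /pair_map /= scalerA.
Qed.

Fact tens_scale1 : left_id 1 tens_scale.
Proof.
elim/tmk_ind=> l; rewrite tens_scale_mk; congr tmk; rewrite -[RHS]map_id.
by apply: eq_map => -[m y]; rewrite /pair_map /= scale1r.
Qed.

Fact tens_scaleDr : right_distributive tens_scale +%R.
Proof.
move=> r; elim/tmk_ind=> l; elim/tmk_ind=> l'.
rewrite -[tmk l + tmk l']/(tens_add (tmk l) (tmk l')) tens_add_mk !tens_scale_mk.
by rewrite map_cat -[RHS]/(tens_add (tmk _) (tmk _)) tens_add_mk.
Qed.

Fact tens_scaleDl u : {morph tens_scale^~ u : r s / r + s}.
Proof.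
elim/tmk_ind: u => l r s; rewrite !tens_scale_mk.
rewrite -[RHS]/(tens_add _ _) tens_add_mk; apply/tmkP.
elim: l => [|[m y] l IH]; first exact: tens_refl.
set A := pair_map _ _; set B := pair_map _ _; set C := pair_map _ _.
rewrite -[map A _]/([:: A (m, y)] ++ map A l).
rewrite -[_ ++ _ in X in tens_rel _ X]/
  ([:: B (m, y)] ++ (map B l ++ ([:: C (m, y)] ++ map C l))).
apply: (tens_trans (l2 :=
  [:: B (m, y)] ++ ([:: C (m, y)] ++ map C l) ++ map B l)); last first.
  by apply: tens_cat (tens_refl _) (tens_catC _ _).
rewrite -catA catA; apply: tens_cat.
  by rewrite /A /B /C /pair_map /= scalerDl; apply: tens_DL.
exact: tens_trans IH (tens_catC _ _).
Qed.

HB.instance Definition _ := GRing.Zmodule_isLmodule.Build R tensor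
  tens_scaleA tens_scale1 tens_scaleDr tens_scaleDl.

Fact tensZ r m y : tens (r *: m) y = r *: tens m y.
Proof. by rewrite -[RHS]/(tens_scale r (tmk [:: (m, y)])) tens_scale_mk. Qed.

Fact tens0l y : tens (0 : M) y = 0.
Proof. by rewrite -(scale0r (0 : M)) tensZ scale0r. Qed.

Fact tensDl m m' y : tens (m + m') y = tens m y + tens m' y.
Proof.
by rewrite -[RHS]/(tens_add (tmk _) (tmk _)) tens_add_mk; apply/tmkP/tens_DL.
Qed.

Fact tensDr m y y' : tens m (y + y') = tens m y + tens m y'.
Proof.
by rewrite -[RHS]/(tens_add (tmk _) (tmk _)) tens_add_mk; apply/tmkP/tens_DR.
Qed.

Fact tensS m s y : tens (rscale m s) y = tens m (s *: y).
Proof. by apply/tmkP/tens_S. Qed.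

End TensorModule.

Section TensorMap.
Variables (Y Y' : lmodType S) (g : {linear Y -> Y'}).

Definition tens_map (u : tensor Y) : tensor Y' :=
  tmk (map (pair_map idfun g) (repr u)).

Fact tens_map_mk l : tens_map (tmk l) = tmk (map (pair_map idfun g) l).
Proof. by apply/tmkP/tens_rel_map => //; apply: tmk_repr. Qed.

Fact tens_map_linear : linear tens_map.
Proof.
move=> r; elim/tmk_ind=> l; elim/tmk_ind=> l'.
rewrite -[_ *: _ + _]/(tens_add (tens_scale _ _) _).
rewrite -[RHS]/(tens_add (tens_scale _ _) _).
by rewrite tens_scale_mk tens_add_mk !tens_map_mk tens_scale_mk tens_add_mk
  map_cat -!map_comp.
Qed.

HB.instance Definition _ := GRing.isLinear.Build R (tensor Y) (tensor Y') *:%R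
  tens_map tens_map_linear.

End TensorMap.

Section Adjoint.
Variables (X : lmodType R) (Y : lmodType S) (phi : {linear tensor Y -> X}).

Definition adj_app (y : Y) (m : M) : X := phi (tens m y).

Fact adj_app_linear y : linear (adj_app y).
Proof. by move=> r m m'; rewrite /adj_app tensDl tensZ linearP. Qed.

HB.instance Definition _ y :=
  GRing.isLinear.Build R M X *:%R (adj_app y) (adj_app_linear y).

(** [phi^M : Y -> Hom_R(M, X)] *)
Definition adj (y : Y) : hom_mod M X := adj_app y.

Fact adj_linear : linear adj.
Proof.
move=> s y y'; apply: hom_ext => m.
rewrite /hom_app /= /adj_app tensDr linearD -tensS.
by [].
Qed.

HB.instance Definition _ :=
  GRing.isLinear.Build S Y (hom_mod M X) *:%R adj adj_linear.

End Adjoint.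
End Tensor.

Arguments tens_map {R S} M {Y Y'} g u.

Section Triangular.
Variables (R S : pzRingType) (M : bimodule R S).

(** [(r, m, s)] is the matrix with rows [(r, m)] and [(0, s)]. *)
Definition tri_ring : Type := (R * M * S)%type.

HB.instance Definition _ := GRing.Zmodule.copy tri_ring (R * M * S)%type.

Definition tri_one : tri_ring := (1, 0, 1).
Definition tri_mul (a b : tri_ring) : tri_ring :=
  (a.1.1 * b.1.1, a.1.1 *: b.1.2 + rscale a.1.2 b.2, a.2 * b.2).

Fact rscale0l s : rscale (0 : M) s = 0.
Proof. by rewrite -(scale0r 0) rscale_scale !scale0r. Qed.

Fact rscale0r (m : M) : rscale m 0 = 0.
Proof. by apply: (addrI (rscale m 0)); rewrite -rscaleDr !addr0. Qed.

Fact tri_mulA : associative tri_mul.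
Proof.
move=> a b c; rewrite /tri_mul /= !mulrA; congr (_, _, _).
by rewrite scalerDr scalerA rscaleDl rscale_scale rscaleA addrA.
Qed.

Fact tri_mul1 : left_id tri_one tri_mul.
Proof.
by move=> [[r m] s]; rewrite /tri_mul /= !mul1r scale1r rscale0l addr0.
Qed.

Fact tri_mulr1 : right_id tri_one tri_mul.
Proof.
by move=> [[r m] s]; rewrite /tri_mul /= !mulr1 scaler0 rscale1 add0r.
Qed.

Fact tri_mulDl : left_distributive tri_mul +%R.
Proof.
move=> a b c; rewrite /tri_mul /= !mulrDl scalerDl rscaleDl.
by congr (_, _, _); rewrite addrACA.
Qed.

Fact tri_mulDr : right_distributive tri_mul +%R.
Proof.
move=> a b c; rewrite /tri_mul /= !mulrDr scalerDr rscaleDr.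
by congr (_, _, _); rewrite addrACA.
Qed.

HB.instance Definition _ := GRing.Zmodule_isPzRing.Build tri_ring
  tri_mulA tri_mul1 tri_mulr1 tri_mulDl tri_mulDr.

Section TriangularModule.
Variables (X : lmodType R) (Y : lmodType S) (phi : {linear tensor M Y -> X}).

(** The triple [(X, Y)_phi] as the module of column vectors [(x, y)] over
    [tri_ring]. *)
Definition tri_mod (_ : {linear tensor M Y -> X}) : Type := (X * Y)%type.

HB.instance Definition _ := GRing.Zmodule.copy (tri_mod phi) (X * Y)%type.

Definition tri_scale (a : tri_ring) (v : tri_mod phi) : tri_mod phi :=
  (a.1.1 *: v.1 + phi (tens a.1.2 v.2), a.2 *: v.2).

Fact tri_scaleA a b v : tri_scale a (tri_scale b v) = tri_scale (a * b) v.
Proof.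
rewrite /tri_scale /= scalerA; congr (_, _).
by rewrite scalerDr scalerA tensDl tensZ tensS linearD linearZ addrA.
Qed.

Fact tri_scale1 : left_id 1 tri_scale.
Proof.
by move=> [x y]; rewrite /tri_scale /= !scale1r tens0l linear0 addr0.
Qed.

Fact tri_scaleDr : right_distributive tri_scale +%R.
Proof.
move=> a v w; rewrite /tri_scale /= !scalerDr tensDr linearD.
by congr (_, _); rewrite addrACA.
Qed.

Fact tri_scaleDl v : {morph tri_scale^~ v : a b / a + b}.
Proof.
move=> a b; rewrite /tri_scale /= !scalerDl tensDl linearD.
by congr (_, _); rewrite addrACA.
Qed.

HB.instance Definition _ := GRing.Zmodule_isLmodule.Build tri_ring (tri_mod phi)
  tri_scaleA tri_scale1 tri_scaleDr tri_scaleDl.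

End TriangularModule.
End Triangular.

(** [... -> term 1 -> term 0 -> A -> 0] exact *)
Record resolution (R : pzRingType) (A : lmodType R) := Resolution {
  term : nat -> lmodType R;
  diff : forall i, {linear term i.+1 -> term i};
  aug : {linear term 0 -> A};
  aug_surj : surj aug;
  exact_aug : exact (diff 0) aug;
  exact_diff : forall i, exact (diff i.+1) (diff i) }.

(** [0 -> A -> coterm 0 -> coterm 1 -> ...] exact *)
Record coresolution (R : pzRingType) (A : lmodType R) := Coresolution {
  coterm : nat -> lmodType R;
  codiff : forall i, {linear coterm i -> coterm i.+1};
  coaug : {linear A -> coterm 0};
  coaug_inj : injective coaug;
  exact_coaug : exact coaug (codiff 0);
  exact_codiff : forall i, exact (codiff i) (codiff i.+1) }.

Definition projective (R : pzRingType) (P : lmodType R) : Prop :=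
  forall (B C : lmodType R) (p : {linear B -> C}) (f : {linear P -> C}),
    surj p -> exists g : {linear P -> B}, forall x, p (g x) = f x.

(** [H^i(Hom_R(P, B)) = 0]: the [i]-cocycles are coboundaries. *)
Definition hom_cohomology_zero (R : pzRingType) (A B : lmodType R)
    (P : resolution A) (i : nat) : Prop :=
  match i with
  | 0 => forall f : {linear term P 0 -> B},
      (forall x, f (diff P 0 x) = 0) -> forall x, f x = 0
  | i'.+1 => forall f : {linear term P i'.+1 -> B},
      (forall x, f (diff P i'.+1 x) = 0) ->
      exists g : {linear term P i' -> B}, forall x, f x = g (diff P i' x)
  end.

(** [Ext^i_R(A, B) = 0], with [Ext] computed from projective resolutions of [A];
    the cohomology does not depend on the resolution. *)
Definition Ext_zero (R : pzRingType) (i : nat) (A B : lmodType R) : Prop :=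
  forall P : resolution A, (forall j, projective (term P j)) ->
    hom_cohomology_zero B P i.

(** [H_i(M (x)_S P) = 0]: the [i]-cycles are boundaries. *)
Definition tens_homology_zero (R S : pzRingType) (M : bimodule R S)
    (Y : lmodType S) (P : resolution Y) (i : nat) : Prop :=
  match i with
  | 0 => surj (tens_map M (diff P 0))
  | i'.+1 => forall u, tens_map M (diff P i') u = 0 ->
      exists v, tens_map M (diff P i'.+1) v = u
  end.

Definition Tor_zero (R S : pzRingType) (i : nat) (M : bimodule R S)
    (Y : lmodType S) : Prop :=
  forall P : resolution Y, (forall j, projective (term P j)) ->
    tens_homology_zero M P i.

Section Classes.
Variable R : pzRingType.
Implicit Types C D : lmodType R -> Prop.

Definition module_class C : Prop :=
  (exists2 Z : lmodType R, is_zero Z & C Z) /\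
  (forall A B : lmodType R, lmod_iso A B -> C A -> C B).

Definition closed_summands C : Prop :=
  forall A A' B : lmodType R, lmod_iso B (A * A')%type -> C B -> C A.

Definition closed_extensions C : Prop :=
  forall (A B E : lmodType R) (f : {linear A -> E}) (g : {linear E -> B}),
    short_exact f g -> C A -> C B -> C E.

(** [C_m^wedge] and [C_m^vee]; a finite exact sequence is encoded as a
    (co)resolution whose terms beyond the [k]-th are zero. *)
Definition wedge C (m : nat) (A : lmodType R) : Prop :=
  exists k, (k <= m)%N /\ exists P : resolution A,
    (forall i, (i <= k)%N -> C (term P i)) /\
    (forall i, (k < i)%N -> is_zero (term P i)).

Definition vee C (m : nat) (A : lmodType R) : Prop :=
  exists k, (k <= m)%N /\ exists P : coresolution A,
    (forall i, (i <= k)%N -> C (coterm P i)) /\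
    (forall i, (k < i)%N -> is_zero (coterm P i)).

Definition Ext_orthogonal (n : nat) C D : Prop :=
  forall i, (1 <= i <= n)%N -> forall A B : lmodType R, C A -> D B -> Ext_zero i A B.

Definition left_cotorsion_pair (n : nat) C D : Prop :=
  [/\ closed_summands C, Ext_orthogonal n C D &
      forall A : lmodType R, exists (K B : lmodType R) (f : {linear K -> B}) (g : {linear B -> A}),
        [/\ short_exact f g, C B & wedge D n.-1 K]].

Definition right_cotorsion_pair (n : nat) C D : Prop :=
  [/\ closed_summands D, Ext_orthogonal n C D &
      forall A : lmodType R, exists (B K : lmodType R) (f : {linear A -> B}) (g : {linear B -> K}),
        [/\ short_exact f g, D B & vee C n.-1 K]].

End Classes.

(** The classes of [tri_ring]-modules below are taken up to isomorphism, every
    [tri_ring]-module being isomorphic to some [tri_mod phi]. *)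
Section TriangularClasses.
Variables (R S : pzRingType) (M : bimodule R S).

Definition class_pair (P : lmodType R -> Prop) (Q : lmodType S -> Prop)
    (V : lmodType (tri_ring M)) : Prop :=
  exists (X : lmodType R) (Y : lmodType S) (phi : {linear tensor M Y -> X}),
    [/\ lmod_iso V (tri_mod phi), P X & Q Y].

Definition class_B (CX : lmodType R -> Prop) (CY : lmodType S -> Prop)
    (V : lmodType (tri_ring M)) : Prop :=
  exists (X : lmodType R) (Y : lmodType S) (phi : {linear tensor M Y -> X}),
    [/\ lmod_iso V (tri_mod phi), CY Y, is_zero (kernel phi) & CX (coker phi)].

Definition class_D (CM : lmodType R -> Prop) (CN : lmodType S -> Prop)
    (V : lmodType (tri_ring M)) : Prop :=
  exists (Z : lmodType R) (N : lmodType S) (phi : {linear tensor M N -> Z}),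
    [/\ lmod_iso V (tri_mod phi), CM Z, CN (kernel (adj phi)) &
        is_zero (coker (adj phi))].

End TriangularClasses.

Arguments class_pair {R S} M P Q V.
Arguments class_B {R S} M CX CY V.
Arguments class_D {R S} M CM CN V.

(* Main.v *)
From HB Require Import structures.
From mathcomp Require Import all_boot all_algebra.
From mathcomp Require Import boolp functions.
Require Import Defs.

Set Implicit Arguments.
Unset Strict Implicit.
Unset Printing Implicit Defensive.

Import GRing.Theory.
Local Open Scope ring_scope.

(** Let [L] be the triangular ring.  The statement transfers the three parts of the
    definition of a cotorsion pair along four functors: the exact component
    functors [comp1] and [comp2] from [L]-modules to [R]-modules and to
    [S]-modules, and the inclusions [inc1 X = (X, 0)] and [inc2 Y = (0, Y)].

    Closure under summands holds because [inc1] and [inc2] preserve direct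
    sums ([closed_summands_components]).

    Orthogonality uses two adjunctions.  As [inc1] is exact, preserves projectives
    and is left adjoint to [comp1], one has
    [Ext_L((X, 0), (Z, N)) = Ext_R(X, Z)] ([Ext_zero_inc1]).  As [comp2] is exact,
    preserves projectives and is left adjoint to [inc2], one has
    [Ext_L((X, Y), (0, N)) = Ext_S(Y, N)] ([Ext_zero_comp2]).  It remains to choose
    triples in the given classes: [(Z, Hom(M, Z))] and [(0, N)] on the right in
    part (1), [(M (x) Y, Y)] and [(X, 0)] on the left in part (2).

    The approximations of an [R]-module [A] are the first components of those of
    [(A, 0)], and those of an [S]-module [A] are the second components of those of
    [(0, A)].  In (1a) and (2a) the finite resolution of the kernel, or coresolution
    of the cokernel, is also obtained by taking components.  In (1b) the kernel [K]
    has a resolution by modules of [class_D] of length less than [n].  Taking components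
    gives a map from a resolution of the second component [K2] to [Hom(M, -)] of a
    resolution of the first component [K1], and the latter stays exact because the
    [Ext^j(M, -)] vanish on its terms.  This map is surjective with kernels in the
    class [CN], so [K2 -> Hom(M, K1)] is surjective with a kernel that has a finite
    resolution in [CN] ([class_D_wedge]).  Since [K1] is in [CX], closure under
    extensions applies to [K2].  Part (2b) is dual, with [M (x) K2 -> K1] injective
    and its cokernel coresolved in [CX] ([class_B_vee]).

    Vanishing of Ext and of Tor is treated once, for a class of monomorphisms with
    a few formal properties ([mono_class]): in both cases degree one says that
    every short exact sequence ending in a given module starts with a map of the
    class, and higher degrees are obtained from syzygies.  The main tool is
    dimension shifting ([acyclic_shift]), which also shows that the choice of a
    projective resolution does not matter. *)

(** * Linear maps and kernels *)
Section Linear.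
Variable R : pzRingType.
Implicit Types A B C : lmodType R.

Lemma linear_ext A B (f g : {linear A -> B}) : (forall x, f x = g x) -> f = g.
Proof.
move=> fg; have E : (f : A -> B) = (g : A -> B) by apply: funext.
case: f g E {fg} => [f cf] [g cg] /= E; subst g; congr GRing.Linear.Pack.
case: cf cg => [c1 [c2]] [d1 [d2]]; have -> : c2 = d2 by apply: Prop_irrelevance.
congr GRing.Linear.Class; case: c1 d1 => [c1] [d1].
by congr GRing.isNmodMorphism.Axioms_; apply: Prop_irrelevance.
Qed.

Definition mklin A B (f : A -> B) (lf : linear f) : {linear A -> B} :=
  HB.pack f (GRing.isLinear.Build R A B *:%R f lf).

Lemma inj_lin A B (f : {linear A -> B}) :
  (forall x, f x = 0 -> x = 0) -> injective f.
Proof.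
by move=> f0 x y /eqP; rewrite -subr_eq0 -linearB => /eqP/f0/eqP; rewrite subr_eq0 => /eqP.
Qed.

Lemma bij_inj_surj (T U : Type) (f : T -> U) : injective f -> surj f -> bijective f.
Proof.
move=> fI /choice[g gK]; exists g => // x; apply: fI; exact: gK.
Qed.

Lemma factor_surj A B C (p : {linear A -> B}) (f : {linear A -> C}) :
  surj p -> (forall x, p x = 0 -> f x = 0) ->
  exists g : {linear B -> C}, forall x, g (p x) = f x.
Proof.
move=> /choice[s sK] kerp.
have eqf x y : p x = p y -> f x = f y.
  move=> /eqP; rewrite -subr_eq0 -linearB => /eqP/kerp/eqP.
  by rewrite linearB subr_eq0 => /eqP.
have lg : linear (fun y => f (s y)).
  by move=> a y z; rewrite -linearP; apply: eqf; rewrite linearP !sK.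
by exists (mklin lg) => x; apply: eqf; rewrite sK.
Qed.

Lemma factor_inj A B C (i : {linear A -> B}) (f : {linear C -> B}) :
  injective i -> (forall z, exists x, i x = f z) ->
  exists g : {linear C -> A}, forall z, i (g z) = f z.
Proof.
move=> iI /choice[g gK].
have lg : linear g by move=> a y z; apply: iI; rewrite linearP !gK linearP.
by exists (mklin lg).
Qed.

(** The inclusion of a kernel is picked out by this property, so that no proof
    depends on the representation of its elements. *)
Fact ker_incl_spec A B (f : {linear A -> B}) : exists i : {linear kernel f -> A},
  injective i /\ forall x, f x = 0 <-> exists u, i u = x.
Proof.
exists val; split=> [|x]; first exact: val_inj.
split=> [fx|[[u fu] <-]]; last exact/eqP.
have ku : in_ker f x by apply/eqP.
by exists (Kernel ku).
Qed.

Definition ker_incl A B (f : {linear A -> B}) : {linear kernel f -> A} :=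
  projT1 (cid (ker_incl_spec f)).

Lemma ker_incl_inj A B (f : {linear A -> B}) : injective (ker_incl f).
Proof. by rewrite /ker_incl; case: cid => i [iI iE]. Qed.

Lemma ker_inclP A B (f : {linear A -> B}) x :
  f x = 0 <-> exists u, ker_incl f u = x.
Proof. by rewrite /ker_incl; case: cid => i [iI iE]. Qed.

End Linear.

(** * Free modules and free resolutions *)
Section Free.
Variables (R : pzRingType) (T : choiceType).

Definition finsupp : {pred T -> R^o} :=
  fun f => `[< exists s : seq T, forall t, t \notin s -> f t = 0 >].

Fact finsupp_closed : submod_closed finsupp.
Proof.
split=> [|a f g]; first by apply/asboolP; exists [::].
move=> /asboolP[s fs] /asboolP[s' gs].
apply/asboolP; exists (s ++ s') => t; rewrite mem_cat negb_or => /andP[ts ts'].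
rewrite -[LHS]/(a *: f t + g t) fs // gs //.
by rewrite scaler0 addr0.
Qed.

HB.instance Definition _ :=
  GRing.isSubmodClosed.Build R (T -> R^o) finsupp finsupp_closed.

Record free_mod := FreeMod { free_val : T -> R^o; _ : finsupp free_val }.

HB.instance Definition _ := [isSub for free_val].
HB.instance Definition _ := [Choice of free_mod by <:].
HB.instance Definition _ := [SubChoice_isSubLmodule of free_mod by <:].

End Free.

Section FreeMap.
Variables (R : pzRingType) (T : choiceType) (B : lmodType R) (h : T -> B).
Implicit Type x : free_mod R T.

Definition fcoef x : T -> R := val x.

Fact fsupp_exists x : exists s : seq T, forall t, t \notin s -> fcoef x t = 0.
Proof. by case: x => f fP; have /asboolP := fP. Qed.

Definition fsupp x : seq T := undup (projT1 (cid (fsupp_exists x))).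

Fact fsuppP x t : t \notin fsupp x -> fcoef x t = 0.
Proof. by rewrite mem_undup; case: cid => s /= sP /sP. Qed.

Definition free_map x : B := \sum_(t <- fsupp x) fcoef x t *: h t.

(** The support list is a choice; independence of it is what makes [free_map]
    linear, since the supports of [x], [y] and [a *: x + y] differ. *)
Lemma free_map_sum (s : seq T) x : uniq s ->
  (forall t, t \notin s -> fcoef x t = 0) ->
  free_map x = \sum_(t <- s) fcoef x t *: h t.
Proof.
move=> us sP.
have E (r1 r2 : seq T) : (forall t, t \notin r2 -> fcoef x t = 0) ->
    \sum_(t <- r1) fcoef x t *: h t = \sum_(t <- [seq t <- r1 | t \in r2]) fcoef x t *: h t.
  move=> r2P; rewrite big_filter [RHS]big_mkcond; apply: eq_bigr => t _.
  by case: ifPn => // /r2P ->; rewrite scale0r.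
rewrite /free_map (E _ s) // (E s (fsupp x)); last exact: fsuppP.
apply: perm_big; apply: uniq_perm; rewrite ?filter_uniq ?undup_uniq //.
by move=> t; rewrite !mem_filter andbC.
Qed.

Fact free_map_linear : linear free_map.
Proof.
move=> a x y; pose s := undup (fsupp (a *: x + y) ++ fsupp x ++ fsupp y).
have us : uniq s by apply: undup_uniq.
have sP z : {subset fsupp z <= s} -> forall t, t \notin s -> fcoef z t = 0.
  by move=> zs t ts; apply: fsuppP; apply: contra ts => /zs.
rewrite !(@free_map_sum s) //; try by apply: sP => t tz;
  rewrite mem_undup !mem_cat tz ?orbT.
rewrite scaler_sumr -big_split; apply: eq_bigr => t _ /=.
by rewrite scalerA -scalerDl.
Qed.

HB.instance Definition _ := GRing.isLinear.Build R (free_mod R T) B *:%R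
  free_map free_map_linear.

Fact fbasis_finsupp (t : T) : finsupp (fun u => (u == t)%:R : R^o).
Proof.
by apply/asboolP; exists [:: t] => u; rewrite inE => /negPf ->.
Qed.

Definition fbasis (t : T) : free_mod R T := FreeMod (fbasis_finsupp t).

Lemma free_map_basis t : free_map (fbasis t) = h t.
Proof.
rewrite (@free_map_sum [:: t]) //; first by rewrite big_seq1 /fcoef /= eqxx scale1r.
by move=> u; rewrite inE /fcoef /= => /negPf ->.
Qed.

End FreeMap.

Arguments fbasis R {T} t.

Lemma free_map_expand (R : pzRingType) (T : choiceType) (x : free_mod R T) :
  free_map (fbasis R) x = x.
Proof.
pose ev u : free_mod R T -> R^o := fun x => fcoef x u.
have lev u : linear (ev u) by [].
apply: val_inj; apply: funext => u.
rewrite -[LHS]/(mklin (lev u) _) linear_sum.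
transitivity (\sum_(t <- fsupp x) if t == u then fcoef x t else 0).
  apply: eq_bigr => t _; rewrite linearZ /= /ev /fcoef /= eq_sym.
  by case: eqP => _; rewrite -[LHS]/(_ * _) ?mulr1 ?mulr0.
rewrite -big_mkcond /=; have [ux|ux] := boolP (u \in fsupp x).
  by rewrite (big_rem u) //= eqxx big1_seq ?addr0 // => t /andP[/eqP->];
    rewrite mem_rem_uniq ?undup_uniq // inE eqxx.
rewrite -[RHS]/(fcoef x u) fsuppP // big_seq_cond big1 // => t /andP[tx /eqP tu].
by rewrite -tu tx in ux.
Qed.

Lemma free_projective (R : pzRingType) (T : choiceType) : projective (free_mod R T).
Proof.
move=> B C p f pS.
have /choice[b bP] : forall t, exists b, p b = f (fbasis R t) by move=> t; apply: pS.
exists (free_map b) => x; rewrite -[in RHS](free_map_expand x) !linear_sum.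
by apply: eq_bigr => t _; rewrite !linearZ /= bP.
Qed.

Section FreeResolution.
Variables (R : pzRingType) (A : lmodType R).
Implicit Type B : lmodType R.

Definition cover B : {linear free_mod R B -> B} := free_map id.

Lemma cover_surj B : surj (cover B).
Proof. by move=> b; exists (fbasis R b); apply: free_map_basis. Qed.

Fixpoint free_syzygy (i : nat) : lmodType R :=
  if i is i'.+1 then kernel (cover (free_syzygy i')) else A.

Definition free_diff i :
    {linear free_mod R (free_syzygy i.+1) -> free_mod R (free_syzygy i)} :=
  ker_incl (cover (free_syzygy i)) \o cover (free_syzygy i.+1).

Lemma free_diff_eq0 i x : free_diff i x = 0 <-> cover (free_syzygy i.+1) x = 0.
Proof.
rewrite -[free_diff i x]/(ker_incl _ (cover (free_syzygy i.+1) x)).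
split=> [x0|->]; last by rewrite linear0.
by apply: (@ker_incl_inj _ _ _ (cover (free_syzygy i))); rewrite linear0.
Qed.

Lemma im_free_diff i x :
  cover (free_syzygy i) x = 0 <-> exists y, free_diff i y = x.
Proof.
rewrite ker_inclP; split=> [[u <-]|[y <-]]; last by eexists.
by have [y <-] := cover_surj u; exists y.
Qed.

Definition free_resolution : resolution A.
Proof.
refine (@Resolution _ A (fun i => free_mod R (free_syzygy i)) free_diff
  (cover A) _ _ _) => [|y|i y]; first exact: cover_surj.
  exact: (@im_free_diff 0).
by rewrite free_diff_eq0; apply: (@im_free_diff i.+1).
Defined.

End FreeResolution.

(** * Classes of monomorphisms and acyclic modules *)
Section Pairs.
Variable R : pzRingType.
Implicit Types A B C D : lmodType R.

Fact pair_lin_subproof A B C (f : {linear A -> B}) (g : {linear A -> C}) :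
  linear (fun x => (f x, g x)).
Proof. by move=> a x y; rewrite !linearP. Qed.

Definition pair_lin A B C (f : {linear A -> B}) (g : {linear A -> C}) :
    {linear A -> (B * C)%type} := mklin (pair_lin_subproof f g).

Definition copair_lin A B C (f : {linear A -> C}) (g : {linear B -> C}) :
    {linear (A * B)%type -> C} := (f \o fst) \+ (g \o snd).

Lemma projective_pair A B : projective A -> projective B -> projective (A * B)%type.
Proof.
move=> pA pB C D p f pS.
have [g1 g1P] := pA _ _ p (f \o pair_lin idfun \0) pS.
have [g2 g2P] := pB _ _ p (f \o pair_lin \0 idfun) pS.
exists (copair_lin g1 g2) => -[x y]; rewrite /= linearD /= g1P g2P /= -linearD.
by congr (f _); rewrite -[LHS]/(x + 0, 0 + y) addr0 add0r.
Qed.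

Lemma projective_retract A B (i : {linear A -> B}) (r : {linear B -> A}) :
  (forall x, r (i x) = x) -> projective B -> projective A.
Proof.
move=> ri pB C D p f pS; have [g gP] := pB _ _ p (f \o r) pS.
by exists (g \o i) => x; rewrite /= gP /= ri.
Qed.

Lemma projective_zero A : is_zero A -> projective A.
Proof. by move=> A0 B C p f _; exists \0 => x; rewrite (A0 x) !linear0. Qed.

Lemma split_section A B C (f : {linear A -> B}) (g : {linear B -> C}) :
  short_exact f g -> projective C -> exists s : {linear C -> B}, forall x, g (s x) = x.
Proof. by move=> [_ _ gS] pC; have [s sP] := pC _ _ g idfun gS; exists s. Qed.

Lemma split_retraction A B C (f : {linear A -> B}) (g : {linear B -> C}) :
  short_exact f g -> projective C -> exists r : {linear B -> A}, forall x, r (f x) = x.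
Proof.
move=> fg pC; have [s sP] := split_section fg pC; case: fg => fI fgE gS.
have [|r rP] := @factor_inj _ A B B f (idfun \- (s \o g)) fI.
  by move=> y; apply/fgE; rewrite /= linearB /= sP subrr.
exists r => x; apply: fI; rewrite rP /=.
have /fgE -> : exists x', f x' = f x by exists x.
by rewrite linear0 subr0.
Qed.

(** Exactness of [A -> B * C -> D -> 0], where one of the maps to the product is
    taken with a minus sign. *)
Definition pushout_square A B C D (i : {linear A -> B}) (k : {linear A -> C})
    (u : {linear C -> D}) (p : {linear B -> D}) : Prop :=
  [/\ forall a, u (k a) = p (i a),
      forall b c, u c = p b -> exists a, i a = b /\ k a = c &
      forall d, exists c b, d = u c + p b].

(** Two families of linear maps have these properties: those along which all maps
    to a fixed module extend, and those which stay injective under [M (x) -].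
    The properties suffice to develop the vanishing of the right derived functors
    of [Hom(-, B)] and of the left derived functors of [M (x) -] at once. *)
Record mono_class (J : forall A B : lmodType R, {linear A -> B} -> Prop) := MonoClass {
  mono_comp : forall A B C (f : {linear A -> B}) (g : {linear B -> C}),
    J _ _ f -> J _ _ g -> J _ _ (g \o f);
  mono_cancel : forall A B C (f : {linear A -> B}) (g : {linear B -> C}),
    J _ _ (g \o f) -> J _ _ f;
  mono_split : forall A B (f : {linear A -> B}) (r : {linear B -> A}),
    (forall x, r (f x) = x) -> J _ _ f;
  mono_pushout : forall A B C D (i : {linear A -> B}) (k : {linear A -> C})
      (u : {linear C -> D}) (p : {linear B -> D}),
    pushout_square i k u p -> J _ _ i -> J _ _ u }.

End Pairs.

Section Acyclic.
Variables (R : pzRingType) (J : forall A B : lmodType R, {linear A -> B} -> Prop).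
Hypothesis Jm : mono_class J.
Implicit Types A B C E P Q K U V : lmodType R.

(** Vanishing of [Ext^(i+1)(A, B)] or of [Tor_(i+1)(M, A)], according to [J].
    Degree one is stated for all short exact sequences ending in [A], which
    needs no resolution; higher degrees are reached by passing to a syzygy.
    One syzygy is enough, by [acyclic_shift]. *)
Fixpoint acyclic (i : nat) A : Prop :=
  if i is i'.+1 then
    exists (K P : lmodType R) (f : {linear K -> P}) (g : {linear P -> A}),
      [/\ short_exact f g, projective P & acyclic i' K]
  else forall (U V : lmodType R) (u : {linear U -> V}) (v : {linear V -> A}),
      short_exact u v -> J u.

(** In degree one, the kernel inclusion of a map from [V] onto [E] factors as
    [U -> V' -> V], with [V'] the preimage of [A]; both steps are in [J].  In
    higher degrees, the horseshoe construction gives a syzygy of [E] which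
    extends a syzygy of [B] by one of [A]. *)
Lemma acyclic_extension i A E B (f : {linear A -> E}) (g : {linear E -> B}) :
  short_exact f g -> acyclic i A -> acyclic i B -> acyclic i E.
Proof.
elim: i A E B f g => [|i IH] A E B f g [fI fgE gS].
  move=> Aa Ba U V u v [uI uvE vS].
  (* [kernel (g \o v)] is the preimage of [A] in [V]. *)
  pose j := ker_incl (g \o v).
  have [|u' u'P] := factor_inj (f := u) (@ker_incl_inj _ _ _ (g \o v)).
    move=> x; apply/ker_inclP => /=.
    by have /uvE -> : exists x', u x' = u x; [exists x|rewrite linear0].
  have [|v' v'P] := factor_inj (f := v \o j) fI.
    by move=> z; apply/fgE; apply/(@ker_inclP _ _ _ (g \o v)); exists z.
  have -> : u = j \o u' by apply: linear_ext => x; apply/esym/u'P.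
  apply: (mono_comp Jm).
    apply: (Aa _ _ u' v'); split=> [x y xy|y|a].
    - by apply: uI; rewrite -!u'P xy.
    - split=> [y0|[x <-]].
        have /uvE[x xP] : v (j y) = 0 by rewrite -[v (j y)]/((v \o j) y) -v'P y0 linear0.
        by exists x; apply: (@ker_incl_inj _ _ _ (g \o v)); apply: etrans (u'P x) xP.
      apply: fI; rewrite v'P linear0; apply/uvE.
      by exists x; apply/esym/u'P.
    have [y yP] := vS (f a).
    have /(@ker_inclP _ _ _ (g \o v))[z zP] : g (v y) = 0.
      by rewrite yP; apply/fgE; exists a.
    by exists z; apply: fI; rewrite v'P -yP /= -zP.
  apply: (Ba _ _ j (g \o v)); split=> [|y|b]; first exact: ker_incl_inj.
    exact: ker_inclP.
  have [e <-] := gS b; have [y <-] := vS e.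
  by exists y.
move=> [K1 [P [a [b [[aI abE bS] pP aK1]]]]] [K2 [Q [c [d [[cI cdE dS] pQ aK2]]]]].
have [s sP] := pQ _ _ g d gS.
(* The kernel of [p] extends [K2] by [K1]. *)
pose p := copair_lin (f \o b) s.
have gf x : g (f x) = 0 by apply/fgE; exists x.
have ba x : b (a x) = 0 by apply/abE; exists x.
have dc x : d (c x) = 0 by apply/cdE; exists x.
have [|l lP] := factor_inj (f := pair_lin a \0) (@ker_incl_inj _ _ _ p).
  by move=> x; apply/ker_inclP; rewrite /= ba !linear0 addr0.
have [|r rP] := factor_inj (f := snd \o ker_incl p) cI.
  move=> z; apply/cdE.
  have : p (ker_incl p z) = 0 by apply/ker_inclP; exists z.
  move/(congr1 g); rewrite /= linearD /= gf add0r sP linear0 //.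
exists (kernel p), (P * Q)%type, (ker_incl p), p; split.
- split=> [|y|e]; [exact: ker_incl_inj|exact: ker_inclP|].
  have [q qP] := dS (g e).
  have /fgE[x xP] : g (e - s q) = 0 by rewrite linearB sP qP subrr.
  have [y yP] := bS x; exists (y, q); rewrite /p /= yP xP subrK //.
- exact: projective_pair.
- apply: (IH K1 _ K2 l r) => //; split=> [x y /(congr1 (ker_incl p))|z|y].
  + by rewrite !lP => -[/aI].
  + have pz : p (ker_incl p z) = 0 by apply/ker_inclP; exists z.
    split=> [z0|[x <-]]; last by apply: cI; rewrite rP /= lP linear0.
    have s0 : (ker_incl p z).2 = 0 by rewrite -[_.2]/((snd \o ker_incl p) z) -rP z0 linear0.
    have /abE[x xP] : b (ker_incl p z).1 = 0.
      by apply: fI; rewrite linear0 -[RHS]pz /p /= s0 linear0 addr0.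
    exists x; apply: (@ker_incl_inj _ _ _ p); rewrite lP /= xP.
    by rewrite -s0; case: (ker_incl p z).
  + have /fgE[x xP] : g (s (c y)) = 0 by rewrite sP dc.
    have [w wP] := bS x.
    have /ker_inclP[z zP] : p (- w, c y) = 0.
      by rewrite /p /= !linearN /= wP xP addNr.
    by exists z; apply: cI; rewrite rP /= zP.
Qed.

(** Since [E] is [A * P], adding [P] to the last two terms of a sequence
    [U -> V -> A] gives a sequence ending in [E], and cancellation returns to
    [U -> V].  In higher degrees, a syzygy of [E] is also one of [A]: the
    preimage of [A] in a projective module onto [E] is a direct summand of it. *)
Lemma acyclic_summand i A E P (f : {linear A -> E}) (g : {linear E -> P}) :
  short_exact f g -> projective P -> acyclic i E -> acyclic i A.
Proof.
move=> fg pP; have [s sP] := split_section fg pP; have [fI fgE gS] := fg.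
have gf x : g (f x) = 0 by apply/fgE; exists x.
case: i => [|i] aE.
  move=> U V u v [uI uvE vS].
  have vu x : v (u x) = 0 by apply/uvE; exists x.
  apply: (mono_cancel Jm (g := pair_lin idfun (\0 : {linear V -> P}))).
  apply: (aE _ _ _ (copair_lin (f \o v) s)); split=> [x y [/uI]|[y q]|e] //=.
  - split=> [e0|[x [<- <-]]]; last by rewrite vu !linear0 addr0.
    have q0 : q = 0.
      by move/(congr1 g): e0; rewrite linearD gf add0r sP linear0.
    move: e0; rewrite q0 linear0 addr0 => fv0.
    have /uvE[x xP] : v y = 0 by apply: fI; rewrite linear0.
    by exists x; rewrite xP.
  - have /fgE[x xP] : g (e - s (g e)) = 0 by rewrite linearB sP subrr.
    have [y yP] := vS x; exists (y, g e); rewrite /= yP xP subrK //.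
have [K [Q [a [b [[aI abE bS] pQ aK]]]]] := aE.
have ba x : b (a x) = 0 by apply/abE; exists x.
(* [kernel (g \o b)] is the preimage of [A] in [Q]. *)
pose j := ker_incl (g \o b).
have jE : short_exact j (g \o b).
  split=> [|y|e]; [exact: ker_incl_inj|exact: ker_inclP|].
  have [y <-] := gS e; have [q <-] := bS y.
  by exists q.
have [r rP] := split_retraction jE pP.
have [|a' a'P] := factor_inj (f := a) (@ker_incl_inj _ _ _ (g \o b)).
  by move=> x; apply/ker_inclP; rewrite /= ba linear0.
have [|b' b'P] := factor_inj (f := b \o j) fI.
  by move=> z; apply/fgE; apply/(@ker_inclP _ _ _ (g \o b)); exists z.
exists K, (kernel (g \o b)), a', b'; split=> //; last exact: projective_retract rP pQ.
split=> [x y xy|y|x].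
- by apply: aI; rewrite -!a'P xy.
- split=> [y0|[x <-]]; last first.
    by apply: fI; rewrite b'P linear0 -(ba x) -a'P.
  have /abE[x xP] : b (j y) = 0 by rewrite -[b (j y)]/((b \o j) y) -b'P y0 linear0.
  by exists x; apply: (@ker_incl_inj _ _ _ (g \o b)); apply: etrans (a'P x) xP.
- have [y yP] := bS (f x).
  have /(@ker_inclP _ _ _ (g \o b))[z zP] : g (b y) = 0 by rewrite yP.
  by exists z; apply: fI; rewrite b'P -yP -zP.
Qed.

Lemma acyclic_projective i P : projective P -> acyclic i P.
Proof.
elim: i P => [|i IH] P pP.
  move=> U V u v uv; have [r rP] := split_retraction uv pP.
  exact: (mono_split Jm rP).
have K0 : is_zero (kernel (idfun : {linear P -> P})).
  by move=> x; apply: val_inj; case: x => x /= /eqP.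
exists (kernel (idfun : {linear P -> P})), P, (ker_incl idfun), idfun; split=> //.
  by split=> [|y|x]; [exact: ker_incl_inj|exact: ker_inclP|exists x].
by apply: IH; apply: projective_zero.
Qed.

(** Dimension shifting, without the long exact sequence.  The pullback [X] of
    [B -> C] along a projective [P -> C] with kernel [K] is an extension of [B]
    by [K], so it is acyclic; it is also an extension of [P] by [A].

    For [B] projective this says that acyclicity in degree [i.+1] does not
    depend on the syzygy. *)
Lemma acyclic_shift i A B C (f : {linear A -> B}) (g : {linear B -> C}) :
  short_exact f g -> acyclic i B -> acyclic i.+1 C -> acyclic i A.
Proof.
move=> [fI fgE gS] aB [K [P [a [b [[aI abE bS] pP aK]]]]].
have gf x : g (f x) = 0 by apply/fgE; exists x.
have ba x : b (a x) = 0 by apply/abE; exists x.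
(* The kernel of [p] is the pullback of [g] and [b]. *)
pose p := (g \o fst) \- (b \o snd) : {linear (B * P)%type -> C}.
have pE z : g (ker_incl p z).1 = b (ker_incl p z).2.
  apply/eqP; rewrite -subr_eq0; apply/eqP.
  by apply/(@ker_inclP _ _ _ p); exists z.
have [|l lP] := factor_inj (f := pair_lin \0 a) (@ker_incl_inj _ _ _ p).
  by move=> x; apply/ker_inclP; rewrite /= ba linear0 subrr.
have [|k kP] := factor_inj (f := pair_lin f \0) (@ker_incl_inj _ _ _ p).
  by move=> x; apply/ker_inclP; rewrite /= gf linear0 subrr.
have aE : acyclic i (kernel p).
  apply: (acyclic_extension (f := l) (g := fst \o ker_incl p)) aK aB.
  split=> [x y /(congr1 (ker_incl p))|z|y]; first by rewrite !lP => -[/aI].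
    split=> [/= z0|[x <-]]; last by rewrite /= lP.
    have /abE[x xP] : b (ker_incl p z).2 = 0 by rewrite -pE z0 linear0.
    exists x; apply: (@ker_incl_inj _ _ _ p); rewrite lP /= xP.
    by rewrite -z0; case: (ker_incl p z).
  have [w wP] := bS (g y).
  have /(@ker_inclP _ _ _ p)[z zP] : p (y, w) = 0 by rewrite /p /= wP subrr.
  by exists z; rewrite /= zP.
apply: (acyclic_summand (f := k) (g := snd \o ker_incl p)) pP aE.
split=> [x y /(congr1 (ker_incl p))|z|y]; first by rewrite !kP => -[/fI].
  split=> [/= z0|[x <-]]; last by rewrite /= kP.
  have /fgE[x xP] : g (ker_incl p z).1 = 0 by rewrite pE z0 linear0.
  exists x; apply: (@ker_incl_inj _ _ _ p); rewrite kP /= xP.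
  by rewrite -z0; case: (ker_incl p z).
have [w wP] := gS (b y).
have /(@ker_inclP _ _ _ p)[z zP] : p (w, y) = 0 by rewrite /p /= wP subrr.
by exists z; rewrite /= zP.
Qed.

(** Any [U -> V] with cokernel [A] is a pushout of [K -> P]. *)
Lemma acyclic_cover K P A (f : {linear K -> P}) (g : {linear P -> A}) :
  short_exact f g -> projective P -> J f -> acyclic 0 A.
Proof.
move=> [fI fgE gS] pP Jf U V u v [uI uvE vS].
have gf x : g (f x) = 0 by apply/fgE; exists x.
have vu x : v (u x) = 0 by apply/uvE; exists x.
have [p pE] := pP _ _ v g vS.
have [|k kP] := factor_inj (f := p \o f) uI.
  by move=> x; apply/uvE; rewrite /= pE.
apply: (mono_pushout Jm (i := f) (k := k) (p := p)) Jf; split=> [//|b c cb|y].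
  have /fgE[a aP] : g b = 0 by rewrite -pE -cb vu.
  by exists a; split=> //; apply: uI; rewrite kP /= aP cb.
have [b bP] := gS (v y).
have /uvE[c cP] : v (y - p b) = 0 by rewrite linearB pE bP subrr.
by exists c, b; rewrite cP subrK.
Qed.

End Acyclic.

(** * Resolutions and syzygies *)
Section ExactSequence.
(* An exact sequence [... -> E 1 -> E 0 -> 0]; a resolution of [A] is the case
   [E 0 = A].  Treating the augmentation as a differential makes all the
   statements below uniform in the degree. *)
Variables (R : pzRingType) (E : nat -> lmodType R) (d : forall i, {linear E i.+1 -> E i}).
Hypotheses (dS : surj (d 0)) (dE : forall i, exact (d i.+1) (d i)).

Lemma exact_dd i x : d i (d i.+1 x) = 0.
Proof. by apply/dE; exists x. Qed.

Lemma syzygy_ses i :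
  exists2 q : {linear E i.+2 -> kernel (d i)},
    short_exact (ker_incl (d i.+1)) q & forall x, ker_incl (d i) (q x) = d i.+1 x.
Proof.
have [|q qP] := factor_inj (f := d i.+1) (@ker_incl_inj _ _ _ (d i)).
  by move=> x; apply/ker_inclP/exact_dd.
exists q => //; split=> [|y|z]; first exact: ker_incl_inj.
  rewrite -ker_inclP -qP; split=> [->|]; first exact: linear0.
  by move=> q0; apply: (@ker_incl_inj _ _ _ (d i)); rewrite q0 linear0.
have /dE[x xP] : d i (ker_incl (d i) z) = 0 by apply/ker_inclP; exists z.
by exists x; apply: (@ker_incl_inj _ _ _ (d i)); rewrite qP xP.
Qed.

Lemma syzygy0_ses : short_exact (ker_incl (d 0)) (d 0).
Proof. by split; [exact: ker_incl_inj | move=> y; exact: ker_inclP | exact: dS]. Qed.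

(** Here [A] may be any isomorphic copy of [E 0]. *)
Definition resolution_of_sequence (A : lmodType R)
    (f : {linear E 0%N -> A}) (g : {linear A -> E 0%N}) :
  (forall x, g (f x) = x) -> (forall x, f (g x) = x) -> resolution A.
Proof.
move=> gf fg.
refine (@Resolution _ A (fun i => E i.+1) (fun i => d i.+1) (f \o d 0%N) _ _ _).
- by move=> y; have [x xP] := dS (g y); exists x; rewrite /= xP.
- move=> y; rewrite -(@dE 0%N) /=; split=> [/(congr1 g)|->]; last exact: linear0.
  by rewrite gf linear0.
- by move=> i; apply: dE.
Defined.

Variable J : forall A B : lmodType R, {linear A -> B} -> Prop.
Hypothesis Jm : mono_class J.
Hypothesis pE : forall i, projective (E i.+1).

Lemma acyclic_syzygy i j : acyclic J j (kernel (d i)) <-> acyclic J (j + i).+1 (E 0).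
Proof.
elim: i j => [|i IH] j.
  rewrite addn0; split=> [aK|aA].
    by exists (kernel (d 0)), (E 1), (ker_incl _), (d 0); split=> //; apply: syzygy0_ses.
  by apply: (acyclic_shift Jm syzygy0_ses) aA; apply: acyclic_projective.
have [q qE _] := syzygy_ses i.
rewrite addnS -addSn -IH; split=> [aK|aK].
  by exists (kernel (d i.+1)), (E i.+2), (ker_incl _), q.
by apply: (acyclic_shift Jm qE) aK; apply: acyclic_projective.
Qed.

(** The [i]-th syzygy inclusion into the [i]-th projective term decides
    acyclicity in degree [i], whatever the resolution. *)
Lemma acyclicP i : acyclic J i (E 0) <-> J (ker_incl (d i)).
Proof.
case: i => [|i].
  split=> [|JK]; first by apply; apply: syzygy0_ses.
  by apply: (acyclic_cover Jm syzygy0_ses) JK; apply: pE.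
have [q qE _] := syzygy_ses i.
rewrite -[i]add0n -acyclic_syzygy; split=> [|JK]; first by apply; apply: qE.
by apply: (acyclic_cover Jm qE) JK; apply: pE.
Qed.

End ExactSequence.

Section Resolutions.
Variables (R : pzRingType) (A : lmodType R) (P : resolution A).

Definition augterm (i : nat) : lmodType R := if i is i'.+1 then term P i' else A.

Definition augdiff (i : nat) : {linear augterm i.+1 -> augterm i} :=
  match i with 0 => aug P | i'.+1 => diff P i' end.

Lemma augdiff_surj : surj (augdiff 0).
Proof. exact: aug_surj. Qed.

Lemma augdiff_exact i : exact (augdiff i.+1) (augdiff i).
Proof. by case: i => [|i]; [apply: exact_aug|apply: exact_diff]. Qed.

Lemma acyclic_resolution (J : forall A B : lmodType R, {linear A -> B} -> Prop) i :
  mono_class J -> (forall j, projective (term P j)) ->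
  acyclic J i A <-> J _ _ (ker_incl (augdiff i)).
Proof. by move=> Jm pP; apply: (acyclicP augdiff_surj augdiff_exact Jm). Qed.

End Resolutions.

Lemma free_resolution_projective (R : pzRingType) (A : lmodType R) i :
  projective (term (free_resolution A) i).
Proof. exact: free_projective. Qed.

(** * Ext and Tor as instances *)
Section ExtAcyclic.
Variables (R : pzRingType) (B : lmodType R).

Definition extends (U V : lmodType R) (u : {linear U -> V}) : Prop :=
  forall f : {linear U -> B}, exists g : {linear V -> B}, forall x, g (u x) = f x.

Lemma extends_mono_class : mono_class extends.
Proof.
split=> [U V W f g ef eg h|U V W f g egf h|U V f r rf h|A C U V i k u p [uk pb surjV] ei f].
- have [h1 h1P] := ef h; have [h2 h2P] := eg h1.
  by exists h2 => x; rewrite /= h2P h1P.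
- by have [h1 h1P] := egf h; exists (h1 \o g) => x; rewrite -h1P.
- by exists (h \o r) => x; rewrite /= rf.
- have [g gP] := ei (f \o k).
  have [||h hP] := @factor_surj _ _ _ _ (copair_lin u p) (copair_lin f g).
  + by move=> y; have [a [b ->]] := surjV y; exists (a, b).
  + move=> [a b] /= /eqP; rewrite addr_eq0 -linearN => /eqP/pb[c [cb <-]].
    by rewrite -[f (k c)]/((f \o k) c) -gP cb linearN addNr.
  + exists h => x; have := hP (x, 0).
    by rewrite /= !linear0 !addr0.
Qed.

(** A cocycle on the [i.+1]-st term is a map on the [i]-th syzygy, and it is a
    coboundary exactly when that map extends to the [i]-th term. *)
Lemma hom_cohomology_zeroP (A : lmodType R) (P : resolution A) i :
  hom_cohomology_zero B P i.+1 <-> extends (ker_incl (augdiff P i)).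
Proof.
have [q [_ _ qS] qP] := syzygy_ses (augdiff_exact (P := P)) i.
split=> [H f|H f fd].
  have [|g gP] := H (f \o q).
    move=> x; rewrite /=; apply: etrans (linear0 f); congr (f _).
    apply: (@ker_incl_inj _ _ _ (augdiff P i)); rewrite qP linear0.
    exact: (@exact_dd _ _ _ (@augdiff_exact _ _ P) i.+1).
  exists g => y; have [x <-] := qS y.
  by rewrite qP; apply/esym/gP.
have [|f' f'P] := factor_surj (f := f) qS.
  move=> x qx0; have /augdiff_exact[y <-] : augdiff P i.+1 x = 0 by rewrite -qP qx0 linear0.
  exact: fd.
have [g gP] := H f'; exists g => x.
by rewrite -[diff P i x]/(augdiff P i.+1 x) -qP gP f'P.
Qed.

(** Independence of the projective resolution. *)
Lemma hom_cohomology_Ext (A : lmodType R) (P : resolution A) i :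
  (forall j, projective (term P j)) ->
  hom_cohomology_zero B P i.+1 <-> Ext_zero i.+1 A B.
Proof.
move=> pP; split=> [|H]; last exact: H.
move=> H Q pQ; apply/hom_cohomology_zeroP/(acyclic_resolution _ extends_mono_class pQ).
by apply/(acyclic_resolution _ extends_mono_class pP)/hom_cohomology_zeroP.
Qed.

End ExtAcyclic.

Section Tensor.
Variables (R S : pzRingType) (M : bimodule R S).
Implicit Types (X : lmodType R) (Y : lmodType S).

Lemma tmk_sum Y (l : seq (M * Y)) : tmk l = \sum_(p <- l) tens p.1 p.2.
Proof.
elim: l => [|[m y] l IH]; first by rewrite big_nil.
by rewrite big_cons -IH -[RHS]/(tens_add (tmk _) (tmk _)) tens_add_mk.
Qed.

Lemma tensor_ext Y X (f g : {linear tensor M Y -> X}) :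
  (forall m y, f (tens m y) = g (tens m y)) -> forall u, f u = g u.
Proof.
move=> fg; elim/tmk_ind=> l; rewrite tmk_sum !linear_sum.
by apply: eq_bigr => p _; apply: fg.
Qed.

Lemma tens0r Y (m : M) : tens m (0 : Y) = 0.
Proof. by rewrite -(scale0r (0 : Y)) -tensS rscale0r tens0l. Qed.

Lemma tens_map_tens Y Y' (g : {linear Y -> Y'}) m y : tens_map M g (tens m y) = tens m (g y).
Proof. exact: tens_map_mk. Qed.

Lemma tens_map_comp Y Y' Y'' (f : {linear Y -> Y'}) (g : {linear Y' -> Y''}) u :
  tens_map M (g \o f) u = tens_map M g (tens_map M f u).
Proof.
rewrite -[RHS]/((tens_map M g \o tens_map M f) u).
by apply: tensor_ext => m y; rewrite /= !tens_map_tens.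
Qed.

Lemma tens_map_id Y u : tens_map M (idfun : {linear Y -> Y}) u = u.
Proof.
rewrite -[RHS]/(idfun u).
by apply: tensor_ext => m y; rewrite /= !tens_map_tens.
Qed.

Lemma tens_map_0 Y Y' u : tens_map M (\0 : {linear Y -> Y'}) u = 0.
Proof.
rewrite -[RHS]/((\0 : {linear tensor M Y -> tensor M Y'}) u).
by apply: tensor_ext => m y; rewrite /= !tens_map_tens tens0r.
Qed.

Lemma eq_tens_map Y Y' (f g : {linear Y -> Y'}) : (forall y, f y = g y) ->
  forall u, tens_map M f u = tens_map M g u.
Proof. by move=> fg; apply: tensor_ext => m y; rewrite /= !tens_map_tens fg. Qed.

Lemma tens_map_cancel Y Y' (f : {linear Y -> Y'}) (g : {linear Y' -> Y}) :
  (forall y, g (f y) = y) -> forall u, tens_map M g (tens_map M f u) = u.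
Proof.
move=> gf u; rewrite -tens_map_comp -[RHS]tens_map_id.
exact: (eq_tens_map (f := g \o f) (g := idfun)).
Qed.

Lemma tens_map_surj Y Y' (g : {linear Y -> Y'}) : surj g -> surj (tens_map M g).
Proof.
move=> /choice[s sK]; elim/tmk_ind=> l; rewrite tmk_sum.
exists (\sum_(p <- l) tens p.1 (s p.2)); rewrite linear_sum.
by apply: eq_bigr => p _; rewrite /= tens_map_tens sK.
Qed.

(** The universal property of the tensor product. *)
Section Lift.
Variables (Y : lmodType S) (X : lmodType R) (b : M -> Y -> X).
Hypothesis bDl : forall y, {morph b^~ y : m m' / m + m'}.
Hypothesis bDr : forall m, {morph b m : y y' / y + y'}.
Hypothesis bS : forall m s y, b (rscale m s) y = b m (s *: y).
Hypothesis bZ : forall r m y, b (r *: m) y = r *: b m y.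

Definition tlift_seq (l : seq (M * Y)) : X := \sum_(p <- l) b p.1 p.2.

Fact tlift_seq_rel l l' : tens_rel l l' -> tlift_seq l = tlift_seq l'.
Proof.
rewrite /tlift_seq; elim=> {l l'} [//|//|l1 l2 l3 _ -> _ -> //|l1 l1' l2 l2' _ E1 _ E2|
  l1 l2|y|m m' y|m y y'|m s y]; rewrite ?big_cat /= ?big_cons ?big_nil ?addr0 /=.
- by rewrite E1 E2.
- exact: addrC.
- by rewrite -(scale0r (0 : M)) bZ scale0r.
- exact: bDl.
- exact: bDr.
- exact: bS.
Qed.

Definition tlift_fun (u : tensor M Y) : X := tlift_seq (repr u).

Fact tlift_fun_mk l : tlift_fun (tmk l) = tlift_seq l.
Proof. exact/tlift_seq_rel/tmk_repr. Qed.

Fact tlift_linear : linear tlift_fun.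
Proof.
move=> r; elim/tmk_ind=> l; elim/tmk_ind=> l'.
rewrite -[_ *: _ + _]/(tens_add (tens_scale _ _) _) tens_scale_mk tens_add_mk.
rewrite !tlift_fun_mk /tlift_seq big_cat big_map scaler_sumr; congr (_ + _).
by apply: eq_bigr => p _ /=; rewrite bZ.
Qed.

Definition tlift : {linear tensor M Y -> X} := mklin tlift_linear.

Lemma tlift_tens m y : tlift (tens m y) = b m y.
Proof. by rewrite /= tlift_fun_mk /tlift_seq big_seq1. Qed.

End Lift.

Lemma coker_proj_eq0 (A B : lmodType R) (f : {linear A -> B}) y :
  coker_proj f y = 0 <-> exists x, f x = y.
Proof.
rewrite -(linear0 (coker_proj f)) coker_projP subr0.
by split=> [/asboolP|H] //; apply/asboolP.
Qed.

(** The inverse of [coker (M (x) f) -> M (x) Y] is defined on [m (x) y] by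
    lifting [y] along [g]. *)
Lemma tens_right_exact (K P Y : lmodType S) (f : {linear K -> P}) (g : {linear P -> Y}) :
  surj g -> exact f g -> exact (tens_map M f) (tens_map M g).
Proof.
move=> gS fg u; split=> [gu0|[v <-]]; last first.
  rewrite /= -tens_map_comp -[RHS](tens_map_0 _ v); apply: eq_tens_map => x /=.
  by apply/fg; exists x.
have /choice[s sK] := gS.
pose Q := coker (tens_map M f).
pose b m y : Q := coker_proj (tens_map M f) (tens m (s y)).
have bE m x y : g x = y -> b m y = coker_proj (tens_map M f) (tens m x).
  move=> gx; apply/eqP; rewrite -subr_eq0 -linearB; apply/eqP/coker_proj_eq0.
  have /fg[z zP] : g (s y - x) = 0 by rewrite linearB sK gx subrr.
  exists (tens m z); rewrite /= tens_map_tens zP.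
  by apply/eqP; rewrite eq_sym subr_eq -tensDr subrK.
have bDl y : {morph b^~ y : m m' / m + m'} by move=> m m'; rewrite /b tensDl linearD.
have bDr m : {morph b m : y y' / y + y'}.
  by move=> y y'; rewrite (bE m (s y + s y')) ?tensDr ?linearD ?sK.
have bS m t y : b (rscale m t) y = b m (t *: y).
  by rewrite (bE m (t *: s y)) ?linearZ ?sK //= /b tensS.
have bZ r m y : b (r *: m) y = r *: b m y by rewrite /b tensZ linearZ.
pose L := tlift bDl bDr bS bZ.
have LE v : L (tens_map M g v) = coker_proj (tens_map M f) v.
  rewrite -[LHS]/((L \o tens_map M g) v); apply: tensor_ext => m x.
  by rewrite -[LHS]/(L (tens_map M g (tens m x))) tens_map_tens tlift_tens; apply: bE.
by apply/coker_proj_eq0; rewrite -LE gu0 linear0.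
Qed.

Definition tens_mono Y Y' (f : {linear Y -> Y'}) : Prop := injective (tens_map M f).

(** The pushout property: a pushout square gives a right exact sequence
    [M (x) A -> M (x) (U * C) -> M (x) V].  An element [w] of [M (x) U] that
    vanishes in [M (x) V] comes, as an element of [M (x) (U * C)], from some [t]
    in [M (x) A] with [(M (x) i) t = 0]; so [t = 0] and [w = 0]. *)
Lemma tens_mono_class : mono_class tens_mono.
Proof.
split=> [U V W f g fI gI|U V W f g gfI|U V f r rf|A C U V i k u p [uk pb surjV] iI].
- by move=> x y; rewrite /= !tens_map_comp => /gI/fI.
- by move=> x y xy; apply: gfI; rewrite /= !tens_map_comp xy.
- exact: can_inj (tens_map_cancel rf).
apply: inj_lin => w w0.
pose kap := pair_lin (\- k) i; pose pi := copair_lin u p.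
have piS : surj pi by move=> v; have [a [c ->]] := surjV v; exists (a, c).
have kp : exact kap pi.
  move=> [a c]; split=> [/= /eqP|[x [<- <-]]]; last by rewrite /= linearN uk addNr.
  rewrite addrC addr_eq0 -linearN => /eqP pu.
  have [x [xc xa]] := pb c (- a) (esym pu).
  by exists x; rewrite /kap /= xc xa opprK.
pose inl := pair_lin (idfun : {linear U -> U}) (\0 : {linear U -> C}).
have inlE : tens_map M pi (tens_map M inl w) = 0.
  rewrite -tens_map_comp -[RHS]w0; apply: eq_tens_map => x.
  by rewrite /pi /= linear0 addr0.
have [t tP] := (tens_right_exact piS kp (tens_map M inl w)).1 inlE.
have t0 : t = 0.
  apply: iI; rewrite linear0.
  have sw : tens_map M (snd \o inl) w = 0.
    by rewrite -[RHS](@tens_map_0 _ C w); apply: eq_tens_map.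
  by rewrite -[RHS]sw tens_map_comp -tP -tens_map_comp; apply: eq_tens_map.
rewrite -[LHS]tens_map_id (@eq_tens_map _ _ idfun (fst \o inl)) //.
by rewrite tens_map_comp -tP t0 !linear0.
Qed.

Lemma Tor_zero_acyclic Y i : Tor_zero i.+1 M Y -> acyclic tens_mono i Y.
Proof.
pose P := free_resolution Y; have pP := free_resolution_projective (A := Y).
move=> /(_ P pP) H; apply/(acyclic_resolution _ tens_mono_class pP); apply: inj_lin => w /= w0.
have [q [_ _ qS] qP] := syzygy_ses (augdiff_exact (P := P)) i.
have [u uw] := tens_map_surj qS w.
have [|v vu] := H u.
  rewrite -[diff P i]/(augdiff P i.+1) -[RHS]w0 -uw -tens_map_comp.
  by apply: eq_tens_map => x; rewrite /= qP.
rewrite -uw -vu -tens_map_comp -[RHS](tens_map_0 _ v); apply: eq_tens_map => x.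
apply: (@ker_incl_inj _ _ _ (augdiff P i)); rewrite /= qP linear0.
exact: (@exact_dd _ _ _ (@augdiff_exact _ _ P) i.+1).
Qed.

End Tensor.

(** * The components of a module over the triangular ring *)
Section TriRing.
Variables (R S : pzRingType) (M : bimodule R S).
Implicit Types (r : R) (s : S) (m : M).

Definition tri_r r : tri_ring M := (r, 0, 0).
Definition tri_m m : tri_ring M := (0, m, 0).
Definition tri_s s : tri_ring M := (0, 0, s).

Fact tri_rD r r' : tri_r (r + r') = tri_r r + tri_r r'.
Proof. by rewrite -[RHS]/(_, _, _) /= !addr0. Qed.

Fact tri_mD m m' : tri_m (m + m') = tri_m m + tri_m m'.
Proof. by rewrite -[RHS]/(_, _, _) /= !addr0. Qed.

Fact tri_sD s s' : tri_s (s + s') = tri_s s + tri_s s'.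
Proof. by rewrite -[RHS]/(_, _, _) /= !addr0. Qed.

Fact tri_rM r r' : tri_r r * tri_r r' = tri_r (r * r').
Proof. by rewrite -[LHS]/(_, _, _) /= scaler0 rscale0l mulr0 addr0. Qed.

Fact tri_rmM r m : tri_r r * tri_m m = tri_m (r *: m).
Proof. by rewrite -[LHS]/(_, _, _) /= mulr0 rscale0l mulr0 addr0. Qed.

Fact tri_msM m s : tri_m m * tri_s s = tri_m (rscale m s).
Proof. by rewrite -[LHS]/(_, _, _) /= mulr0 scaler0 mul0r add0r. Qed.

Fact tri_sM s s' : tri_s s * tri_s s' = tri_s (s * s').
Proof. by rewrite -[LHS]/(_, _, _) /= mulr0 scaler0 rscale0l addr0. Qed.

Section Components.
Variable V : lmodType (tri_ring M).

(** With [e1 = tri_r 1] and [e2 = tri_s 1] the diagonal idempotents, the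
    components of [V] are [e1 V] and [e2 V], as fixed points of the idempotents.
    Unlike a decomposition of [V] as a triple, they are functors of [V]. *)
Definition in_comp1 : {pred V} := fun v => tri_r 1 *: v == v.
Definition in_comp2 : {pred V} := fun v => tri_s 1 *: v == v.

Fact in_comp1_closed : zmod_closed in_comp1.
Proof.
split=> [|u v]; rewrite /in_comp1 /in_mem /= ?scaler0 // => /eqP uE /eqP vE.
by rewrite scalerBr uE vE.
Qed.

Fact in_comp2_closed : zmod_closed in_comp2.
Proof.
split=> [|u v]; rewrite /in_comp2 /in_mem /= ?scaler0 // => /eqP uE /eqP vE.
by rewrite scalerBr uE vE.
Qed.

HB.instance Definition _ := GRing.isZmodClosed.Build V in_comp1 in_comp1_closed.
HB.instance Definition _ := GRing.isZmodClosed.Build V in_comp2 in_comp2_closed.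

Record comp1 := Comp1 { comp1_val : V; _ : in_comp1 comp1_val }.
Record comp2 := Comp2 { comp2_val : V; _ : in_comp2 comp2_val }.

HB.instance Definition _ := [isSub for comp1_val].
HB.instance Definition _ := [Choice of comp1 by <:].
HB.instance Definition _ := [SubChoice_isSubZmodule of comp1 by <:].
HB.instance Definition _ := [isSub for comp2_val].
HB.instance Definition _ := [Choice of comp2 by <:].
HB.instance Definition _ := [SubChoice_isSubZmodule of comp2 by <:].

Fact comp1_valP u : tri_r 1 *: comp1_val u = comp1_val u.
Proof. by case: u => v vP; apply/eqP. Qed.

Fact comp2_valP u : tri_s 1 *: comp2_val u = comp2_val u.
Proof. by case: u => v vP; apply/eqP. Qed.

Fact in_comp1_r r v : in_comp1 (tri_r r *: v).
Proof. by rewrite /in_comp1 scalerA tri_rM mul1r. Qed.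

Fact in_comp1_m m v : in_comp1 (tri_m m *: v).
Proof. by rewrite /in_comp1 scalerA tri_rmM scale1r. Qed.

Fact in_comp2_s s v : in_comp2 (tri_s s *: v).
Proof. by rewrite /in_comp2 scalerA tri_sM mul1r. Qed.

Definition comp1_scale r (u : comp1) : comp1 := Comp1 (in_comp1_r r (comp1_val u)).
Definition comp2_scale s (u : comp2) : comp2 := Comp2 (in_comp2_s s (comp2_val u)).

Fact comp1_scaleA r r' u : comp1_scale r (comp1_scale r' u) = comp1_scale (r * r') u.
Proof. by apply: val_inj; rewrite /= scalerA tri_rM. Qed.

Fact comp1_scale1 : left_id 1 comp1_scale.
Proof. by move=> u; apply: val_inj; rewrite /= comp1_valP. Qed.

Fact comp1_scaleDr : right_distributive comp1_scale +%R.
Proof. by move=> r u v; apply: val_inj; rewrite /= scalerDr. Qed.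

Fact comp1_scaleDl u : {morph comp1_scale^~ u : r r' / r + r'}.
Proof. by move=> r r'; apply: val_inj; rewrite /= tri_rD scalerDl. Qed.

HB.instance Definition _ := GRing.Zmodule_isLmodule.Build R comp1
  comp1_scaleA comp1_scale1 comp1_scaleDr comp1_scaleDl.

Fact comp2_scaleA s s' u : comp2_scale s (comp2_scale s' u) = comp2_scale (s * s') u.
Proof. by apply: val_inj; rewrite /= scalerA tri_sM. Qed.

Fact comp2_scale1 : left_id 1 comp2_scale.
Proof. by move=> u; apply: val_inj; rewrite /= comp2_valP. Qed.

Fact comp2_scaleDr : right_distributive comp2_scale +%R.
Proof. by move=> s u v; apply: val_inj; rewrite /= scalerDr. Qed.

Fact comp2_scaleDl u : {morph comp2_scale^~ u : s s' / s + s'}.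
Proof. by move=> s s'; apply: val_inj; rewrite /= tri_sD scalerDl. Qed.

HB.instance Definition _ := GRing.Zmodule_isLmodule.Build S comp2
  comp2_scaleA comp2_scale1 comp2_scaleDr comp2_scaleDl.

Definition to_comp1 (v : V) : comp1 := Comp1 (in_comp1_r 1 v).
Definition to_comp2 (v : V) : comp2 := Comp2 (in_comp2_s 1 v).

Lemma to_comp2K u : to_comp2 (comp2_val u) = u.
Proof. by apply: val_inj; apply: comp2_valP. Qed.

Definition comp_mul m (u : comp2) : comp1 := Comp1 (in_comp1_m m (comp2_val u)).

Fact comp_mulDl u : {morph comp_mul^~ u : m m' / m + m'}.
Proof. by move=> m m'; apply: val_inj; rewrite /= tri_mD scalerDl. Qed.

Fact comp_mulDr m : {morph comp_mul m : u u' / u + u'}.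
Proof. by move=> u u'; apply: val_inj; rewrite /= scalerDr. Qed.

Fact comp_mulS m s u : comp_mul (rscale m s) u = comp_mul m (s *: u).
Proof. by apply: val_inj; rewrite /= scalerA tri_msM. Qed.

Fact comp_mulZ r m u : comp_mul (r *: m) u = r *: comp_mul m u.
Proof. by apply: val_inj; rewrite /= scalerA tri_rmM. Qed.

(** The structure map of the triple that corresponds to [V]. *)
Definition comp_phi : {linear tensor M comp2 -> comp1} :=
  tlift comp_mulDl comp_mulDr comp_mulS comp_mulZ.

Lemma comp_phi_tens m u : comp_phi (tens m u) = comp_mul m u.
Proof. exact: tlift_tens. Qed.

End Components.

Section ComponentMaps.
Variables (V W : lmodType (tri_ring M)) (f : {linear V -> W}).

Fact comp1_map_subproof (u : comp1 V) : in_comp1 (f (comp1_val u)).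
Proof. by rewrite /in_comp1 -linearZ comp1_valP. Qed.

Fact comp2_map_subproof (u : comp2 V) : in_comp2 (f (comp2_val u)).
Proof. by rewrite /in_comp2 -linearZ comp2_valP. Qed.

Definition comp1_map_fun (u : comp1 V) : comp1 W := Comp1 (comp1_map_subproof u).
Definition comp2_map_fun (u : comp2 V) : comp2 W := Comp2 (comp2_map_subproof u).

Fact comp1_map_linear : linear comp1_map_fun.
Proof. by move=> r u v; apply: val_inj; rewrite /= linearD linearZ. Qed.

Fact comp2_map_linear : linear comp2_map_fun.
Proof. by move=> r u v; apply: val_inj; rewrite /= linearD linearZ. Qed.

Definition comp1_map : {linear comp1 V -> comp1 W} := mklin comp1_map_linear.
Definition comp2_map : {linear comp2 V -> comp2 W} := mklin comp2_map_linear.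

Lemma comp2_map_to v : comp2_map (to_comp2 v) = to_comp2 (f v).
Proof. by apply: val_inj; rewrite /= linearZZ. Qed.

Lemma comp_phi_natural u : comp1_map (comp_phi V u) = comp_phi W (tens_map M comp2_map u).
Proof.
rewrite -[LHS]/((comp1_map \o comp_phi V) u) -[RHS]/((comp_phi W \o tens_map M comp2_map) u).
apply: tensor_ext => m y.
rewrite -[LHS]/(comp1_map (comp_phi V (tens m y))).
rewrite -[RHS]/(comp_phi W (tens_map M comp2_map (tens m y))).
rewrite tens_map_tens !comp_phi_tens; apply: val_inj; exact: linearZ.
Qed.

Lemma comp1_map_surj : surj f -> surj comp1_map.
Proof.
move=> fS w; have [v vE] := fS (comp1_val w); exists (to_comp1 v).
by apply: val_inj; rewrite /= linearZ /= vE comp1_valP.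
Qed.

Lemma comp2_map_surj : surj f -> surj comp2_map.
Proof.
move=> fS w; have [v vE] := fS (comp2_val w); exists (to_comp2 v).
by apply: val_inj; rewrite /= linearZ /= vE comp2_valP.
Qed.

Lemma comp1_map_inj : injective f -> injective comp1_map.
Proof. by move=> fI u v /(congr1 val)/fI/val_inj. Qed.

Lemma comp2_map_inj : injective f -> injective comp2_map.
Proof. by move=> fI u v /(congr1 val)/fI/val_inj. Qed.

End ComponentMaps.

Lemma comp1_map_exact (U V W : lmodType (tri_ring M))
    (f : {linear U -> V}) (g : {linear V -> W}) :
  exact f g -> exact (comp1_map f) (comp1_map g).
Proof.
move=> fg v; split=> [/(congr1 val)/fg[u uE]|[u <-]].
  by exists (to_comp1 u); apply: val_inj; rewrite /= linearZ /= uE comp1_valP.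
by apply: val_inj; apply/fg; exists (comp1_val u).
Qed.

Lemma comp2_map_exact (U V W : lmodType (tri_ring M))
    (f : {linear U -> V}) (g : {linear V -> W}) :
  exact f g -> exact (comp2_map f) (comp2_map g).
Proof.
move=> fg v; split=> [/(congr1 val)/fg[u uE]|[u <-]].
  by exists (to_comp2 u); apply: val_inj; rewrite /= linearZ /= uE comp2_valP.
by apply: val_inj; apply/fg; exists (comp2_val u).
Qed.

Lemma comp1_short_exact (U V W : lmodType (tri_ring M))
    (f : {linear U -> V}) (g : {linear V -> W}) :
  short_exact f g -> short_exact (comp1_map f) (comp1_map g).
Proof.
by case=> fI fg gS; split; [exact: comp1_map_inj|exact: comp1_map_exact|exact: comp1_map_surj].
Qed.

Lemma comp2_short_exact (U V W : lmodType (tri_ring M))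
    (f : {linear U -> V}) (g : {linear V -> W}) :
  short_exact f g -> short_exact (comp2_map f) (comp2_map g).
Proof.
by case=> fI fg gS; split; [exact: comp2_map_inj|exact: comp2_map_exact|exact: comp2_map_surj].
Qed.

Lemma comp1_zero (V : lmodType (tri_ring M)) : is_zero V -> is_zero (comp1 V).
Proof. by move=> V0 u; apply: val_inj; apply: V0. Qed.

Lemma comp2_zero (V : lmodType (tri_ring M)) : is_zero V -> is_zero (comp2 V).
Proof. by move=> V0 u; apply: val_inj; apply: V0. Qed.

(** When [h] is an isomorphism from [V] to a triple, the maps [tri_fst_lin] and
    [tri_snd_lin] identify the components of [V] with those of the triple. *)
Section TriMod.
Variables (X : lmodType R) (Y : lmodType S) (phi : {linear tensor M Y -> X}).
Notation T := (tri_mod phi).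

Lemma tri_modE (a : tri_ring M) (v : T) :
  a *: v = (a.1.1 *: v.1 + phi (tens a.1.2 v.2), a.2 *: v.2).
Proof. by []. Qed.

Lemma tri_r_mod r (v : T) : tri_r r *: v = (r *: v.1, 0).
Proof. by rewrite tri_modE /= tens0l linear0 addr0 scale0r. Qed.

Lemma tri_m_mod m (v : T) : tri_m m *: v = (phi (tens m v.2), 0).
Proof. by rewrite tri_modE /= !scale0r add0r. Qed.

Lemma tri_s_mod s (v : T) : tri_s s *: v = (0, s *: v.2).
Proof. by rewrite tri_modE /= scale0r tens0l linear0 addr0. Qed.

Variables (V : lmodType (tri_ring M)) (h : {linear V -> T}).

Definition tri_fst (u : comp1 V) : X := (h (comp1_val u)).1.
Definition tri_snd (u : comp2 V) : Y := (h (comp2_val u)).2.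

Fact tri_fst_linear : linear tri_fst.
Proof.
by move=> r u v; rewrite /tri_fst /= linearD linearZZ tri_r_mod.
Qed.

Fact tri_snd_linear : linear tri_snd.
Proof.
by move=> r u v; rewrite /tri_snd /= linearD linearZZ tri_s_mod.
Qed.

Definition tri_fst_lin : {linear comp1 V -> X} := mklin tri_fst_linear.
Definition tri_snd_lin : {linear comp2 V -> Y} := mklin tri_snd_linear.

Lemma tri_fst_phi u : tri_fst_lin (comp_phi V u) = phi (tens_map M tri_snd_lin u).
Proof.
rewrite -[LHS]/((tri_fst_lin \o comp_phi V) u) -[RHS]/((phi \o tens_map M tri_snd_lin) u).
apply: tensor_ext => m y.
rewrite -[LHS]/(tri_fst_lin (comp_phi V (tens m y))).
rewrite -[RHS]/(phi (tens_map M tri_snd_lin (tens m y))).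
by rewrite tens_map_tens !comp_phi_tens /= /tri_fst /= linearZZ tri_m_mod.
Qed.

Lemma comp1_val_tri (u : comp1 V) : h (comp1_val u) = (tri_fst_lin u, 0).
Proof.
by rewrite -comp1_valP linearZZ tri_r_mod scale1r.
Qed.

Lemma comp2_val_tri (u : comp2 V) : h (comp2_val u) = (0, tri_snd_lin u).
Proof.
by rewrite -comp2_valP linearZZ tri_s_mod scale1r.
Qed.

Lemma tri_fst_inj : injective h -> injective tri_fst_lin.
Proof.
move=> hI u v uv; apply: val_inj; apply: hI.
by rewrite !comp1_val_tri uv.
Qed.

Lemma tri_snd_inj : injective h -> injective tri_snd_lin.
Proof.
move=> hI u v uv; apply: val_inj; apply: hI.
by rewrite !comp2_val_tri uv.
Qed.

Lemma tri_fst_surj : surj h -> surj tri_fst_lin.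
Proof.
move=> hS x; have [v vE] := hS (x, 0); exists (to_comp1 v).
by rewrite /= /tri_fst /= linearZZ vE tri_r_mod scale1r.
Qed.

Lemma tri_snd_surj : surj h -> surj tri_snd_lin.
Proof.
move=> hS y; have [v vE] := hS (0, y); exists (to_comp2 v).
by rewrite /= /tri_snd /= linearZZ vE tri_s_mod scale1r.
Qed.

End TriMod.
End TriRing.

(** * Isomorphisms of modules *)
Section Isos.
Variable R : pzRingType.
Implicit Types A B C : lmodType R.

Lemma lmod_iso_inv A B (f : {linear A -> B}) : injective f -> surj f ->
  exists g : {linear B -> A}, (forall x, g (f x) = x) /\ (forall y, f (g y) = y).
Proof.
move=> fI fS; have [|g gP] := @factor_inj _ A B B f idfun fI; first exact: fS.
by exists g; split=> [x|y]; [apply: fI; rewrite gP|exact: gP].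
Qed.

Lemma lmod_iso_of A B (f : {linear A -> B}) : injective f -> surj f -> lmod_iso A B.
Proof. by move=> fI fS; exists f; apply: bij_inj_surj. Qed.

Lemma lmod_iso_sym A B : lmod_iso A B -> lmod_iso B A.
Proof.
move=> [f [g fK gK]].
have [||h [hf fh]] := @lmod_iso_inv _ _ f; [exact: can_inj fK|by move=> y; exists (g y)|].
by exists h; exists f.
Qed.

Lemma lmod_iso_refl A : lmod_iso A A.
Proof. by exists idfun; exists id. Qed.

Lemma short_exact_iso_l A A' B C (h : {linear A' -> A}) (f : {linear A -> B})
    (g : {linear B -> C}) :
  injective h -> surj h -> short_exact f g -> short_exact (f \o h) g.
Proof.
move=> hI hS [fI fg gS]; split=> [x y /fI/hI //|y|//].
rewrite fg; split=> [[x <-]|[x <-]]; last by exists (h x).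
by have [z <-] := hS x; exists z.
Qed.

Lemma short_exact_iso_r A B C C' (f : {linear A -> B}) (g : {linear B -> C})
    (h : {linear C -> C'}) :
  injective h -> surj h -> short_exact f g -> short_exact f (h \o g).
Proof.
move=> hI hS [fI fg gS]; split=> [//|y|z]; last first.
  by have [y <-] := hS z; have [x <-] := gS y; exists x.
by rewrite -fg /=; split=> [|->]; [rewrite -(linear0 h) => /hI|rewrite linear0].
Qed.

End Isos.

(** * Triples with one zero component *)
Section TriFunctors.
Variables (R S : pzRingType) (M : bimodule R S).

Section TriMap.
Variables (X X' : lmodType R) (Y Y' : lmodType S).
Variables (phi : {linear tensor M Y -> X}) (phi' : {linear tensor M Y' -> X'}).
Variables (f : {linear X -> X'}) (g : {linear Y -> Y'}).
Hypothesis fg : forall u, f (phi u) = phi' (tens_map M g u).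

Definition tri_map_fun (v : tri_mod phi) : tri_mod phi' := (f v.1, g v.2).

Fact tri_map_linear : linear tri_map_fun.
Proof.
by move=> a v w; rewrite /tri_map_fun /= !tri_modE /= !linearD !linearZZ fg tens_map_tens.
Qed.

Definition tri_map : {linear tri_mod phi -> tri_mod phi'} := mklin tri_map_linear.

End TriMap.

Section First.
Variable Y0 : lmodType S.
Hypothesis Y00 : is_zero Y0.
Implicit Types X Z : lmodType R.

(** The triple [(X, 0)]; its zero component is an arbitrary zero module [Y0], so
    that one belonging to a given class can be used. *)
Definition inc1 X : lmodType (tri_ring M) := tri_mod (\0 : {linear tensor M Y0 -> X}).

Fact inc1_map_subproof X X' (f : {linear X -> X'}) u :
  f ((\0 : {linear tensor M Y0 -> X}) u) = (\0 : {linear tensor M Y0 -> X'}) (tens_map M idfun u).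
Proof. exact: linear0. Qed.

Definition inc1_map X X' (f : {linear X -> X'}) : {linear inc1 X -> inc1 X'} :=
  tri_map (inc1_map_subproof f).

Lemma inc1_eta X (v : inc1 X) : v = (v.1, 0).
Proof. by case: v => x y; rewrite (Y00 y). Qed.

Fact inc1_unit_subproof X (x : X) : in_comp1 ((x, 0) : inc1 X).
Proof. by rewrite /in_comp1 tri_r_mod scale1r. Qed.

Definition inc1_unit_fun X (x : X) : comp1 (inc1 X) := Comp1 (inc1_unit_subproof x).

Fact inc1_unit_linear X : linear (@inc1_unit_fun X).
Proof.
move=> r x y; apply: val_inj => /=; rewrite tri_r_mod /=.
by rewrite -[RHS]/(_ + _, _ + _) addr0.
Qed.

Definition inc1_unit X : {linear X -> comp1 (inc1 X)} := mklin (@inc1_unit_linear X).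

Lemma inc1_unit_inj X : injective (inc1_unit X).
Proof. by move=> x y /(congr1 (fun u : comp1 (inc1 X) => (comp1_val u : X * Y0).1)). Qed.

Lemma inc1_unit_surj X : surj (inc1_unit X).
Proof.
move=> u; exists (comp1_val u).1; apply: val_inj => /=.
by rewrite [RHS]inc1_eta.
Qed.

Lemma comp2_inc1_zero X : is_zero (comp2 (inc1 X)).
Proof.
move=> u; apply: val_inj => /=; rewrite -comp2_valP tri_s_mod.
by rewrite (Y00 (_ *: _)).
Qed.

(** The functor [inc1] is left adjoint to [comp1]. *)
Section FromInc1.
Variables (X : lmodType R) (V : lmodType (tri_ring M)) (f : {linear X -> comp1 V}).

Definition from_inc1_fun (v : inc1 X) : V := comp1_val (f v.1).

Fact from_inc1_linear : linear from_inc1_fun.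
Proof.
move=> a v w; rewrite /from_inc1_fun /= addr0 linearD linearZZ /=; congr (_ + _).
rewrite -[in RHS]comp1_valP scalerA; congr (_ *: _).
by rewrite -[RHS]/(_, _, _) /= mulr1 scaler0 rscale0r mulr0 addr0.
Qed.

Definition from_inc1 : {linear inc1 X -> V} := mklin from_inc1_linear.

End FromInc1.

(** A left adjoint of an exact functor preserves projectives. *)
Lemma inc1_projective Q : projective Q -> projective (inc1 Q).
Proof.
move=> pQ B C p f pS.
have [g gP] := pQ _ _ _ (comp1_map f \o inc1_unit Q) (comp1_map_surj pS).
exists (from_inc1 g) => v; rewrite [in RHS](inc1_eta v).
by have /(congr1 val) := gP v.1.
Qed.

Lemma inc1_exact (A B C : lmodType R) (f : {linear A -> B}) (g : {linear B -> C}) :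
  exact f g -> exact (inc1_map f) (inc1_map g).
Proof.
move=> fg v; split=> [v0|[u <-]].
  have /fg[x xE] : g v.1 = 0 by move/(congr1 fst): v0.
  by exists (x, 0); rewrite [RHS]inc1_eta -xE.
by rewrite [LHS]inc1_eta; congr (_, _); apply/fg; exists u.1.
Qed.

Definition inc1_res X (P : resolution X) : resolution (inc1 X).
Proof.
refine (@Resolution _ (inc1 X) (fun i => inc1 (term P i)) (fun i => inc1_map (diff P i))
  (inc1_map (aug P)) _ _ _).
- move=> v; have [x xE] := aug_surj P v.1; exists (x, 0).
  by rewrite [RHS]inc1_eta -xE.
- by apply: inc1_exact; apply: exact_aug.
- by move=> i; apply: inc1_exact; apply: exact_diff.
Defined.

(** The functor [inc1] is exact and preserves projectives, so it carries the given
    resolution of [X] to one of [inc1 X]; cocycles correspond by adjunction. *)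
Lemma Ext_zero_inc1 i X Z N (phi : {linear tensor M N -> Z}) :
  Ext_zero i.+1 (inc1 X) (tri_mod phi) -> Ext_zero i.+1 X Z.
Proof.
move=> H P pP f fd.
pose T := tri_mod phi.
have zc u : f ((\0 : {linear tensor M Y0 -> term P i.+1}) u) =
    phi (tens_map M (\0 : {linear Y0 -> N}) u) by rewrite tens_map_0 !linear0.
have [||G GP] := H (inc1_res P) _ (tri_map zc).
- by move=> j; apply: inc1_projective.
- by move=> v; congr (_, _); apply: fd.
exists (tri_fst_lin G \o inc1_unit _) => x.
by have /(congr1 fst) := GP (x, 0).
Qed.

End First.

Section Second.
Variable X0 : lmodType R.
Hypothesis X00 : is_zero X0.
Implicit Types Y N : lmodType S.

(** The triple [(0, Y)], with an arbitrary zero module [X0] as first component. *)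
Definition inc2 Y : lmodType (tri_ring M) := tri_mod (\0 : {linear tensor M Y -> X0}).

Fact inc2_map_subproof Y Y' (g : {linear Y -> Y'}) u :
  (idfun : {linear X0 -> X0}) ((\0 : {linear tensor M Y -> X0}) u)
    = (\0 : {linear tensor M Y' -> X0}) (tens_map M g u).
Proof. exact: erefl. Qed.

Definition inc2_map Y Y' (g : {linear Y -> Y'}) : {linear inc2 Y -> inc2 Y'} :=
  tri_map (inc2_map_subproof g).

Lemma inc2_eta Y (v : inc2 Y) : v = (0, v.2).
Proof. by case: v => x y; rewrite (X00 x). Qed.

Fact inc2_unit_subproof Y (y : Y) : in_comp2 ((0, y) : inc2 Y).
Proof. by rewrite /in_comp2 tri_s_mod scale1r. Qed.

Definition inc2_unit_fun Y (y : Y) : comp2 (inc2 Y) := Comp2 (inc2_unit_subproof y).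

Fact inc2_unit_linear Y : linear (@inc2_unit_fun Y).
Proof.
move=> s x y; apply: val_inj => /=; rewrite tri_s_mod /=.
by rewrite -[RHS]/(_ + _, _ + _) addr0.
Qed.

Definition inc2_unit Y : {linear Y -> comp2 (inc2 Y)} := mklin (@inc2_unit_linear Y).

Lemma inc2_unit_inj Y : injective (inc2_unit Y).
Proof. by move=> x y /(congr1 (fun u : comp2 (inc2 Y) => (comp2_val u : X0 * Y).2)). Qed.

Lemma inc2_unit_surj Y : surj (inc2_unit Y).
Proof.
move=> u; exists (comp2_val u).2; apply: val_inj => /=.
by rewrite [RHS]inc2_eta.
Qed.

Lemma comp1_inc2_zero Y : is_zero (comp1 (inc2 Y)).
Proof.
move=> u; apply: val_inj => /=; rewrite -comp1_valP tri_r_mod.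
by rewrite (X00 (_ *: _)).
Qed.

(** The functor [inc2] is right adjoint to [comp2]. *)
Section ToInc2.
Variables (Y : lmodType S) (V : lmodType (tri_ring M)) (f : {linear comp2 V -> Y}).

Definition to_inc2_fun (v : V) : inc2 Y := (0, f (to_comp2 v)).

Fact to_inc2_linear : linear to_inc2_fun.
Proof.
move=> a v w; rewrite /to_inc2_fun [RHS]inc2_eta; congr (_, _).
rewrite -[RHS]/(a.2 *: f (to_comp2 v) + f (to_comp2 w)) -linearZZ -linearD; congr (f _).
apply: val_inj; rewrite /= scalerDr !scalerA tri_sM mulr1; congr (_ *: _ + _).
by rewrite -[LHS]/(_, _, _) /= !mul0r scale0r rscale0l addr0 mul1r.
Qed.

Definition to_inc2 : {linear V -> inc2 Y} := mklin to_inc2_linear.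

End ToInc2.

(** Again the left adjoint of an exact functor, here [inc2]. *)
Lemma comp2_projective (P : lmodType (tri_ring M)) : projective P -> projective (comp2 P).
Proof.
move=> pP B C p f pS.
have [|G GP] := pP _ _ (inc2_map p) (to_inc2 f).
  by move=> v; have [x xE] := pS v.2; exists (0, x); rewrite [RHS]inc2_eta -xE.
exists (tri_snd_lin G) => u.
have /(congr1 snd) := GP (comp2_val u).
by rewrite /= to_comp2K.
Qed.

(** The second component of a projective resolution of [V] is a projective
    resolution of [Y], and cocycles correspond by adjunction.  That resolution
    need not be the one for which vanishing is asked, whence the appeal to
    independence of the resolution. *)
Lemma Ext_zero_comp2 i (V : lmodType (tri_ring M)) N Y
    (g : {linear comp2 V -> Y}) (h : {linear Y -> comp2 V}) :
  (forall x, h (g x) = x) -> (forall y, g (h y) = y) ->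
  Ext_zero i.+1 V (inc2 N) -> Ext_zero i.+1 Y N.
Proof.
move=> hg gh H.
have [Q pQ] : exists Q : resolution V, forall j, projective (term Q j).
  by exists (free_resolution V); apply: free_resolution_projective.
have ex j : exact (comp2_map (augdiff Q j.+1)) (comp2_map (augdiff Q j)).
  by apply: comp2_map_exact; apply: augdiff_exact.
have su : surj (comp2_map (augdiff Q 0)) by apply: comp2_map_surj; apply: aug_surj.
pose P := @resolution_of_sequence _ (fun j => comp2 (augterm Q j))
  (fun j => comp2_map (augdiff Q j)) su ex _ g h hg gh.
apply/(@hom_cohomology_Ext _ _ _ P) => [j|f fd].
  by apply: comp2_projective; apply: pQ.
have [|G GP] := H Q pQ (to_inc2 f).
  move=> v; rewrite [LHS]inc2_eta; congr (_, _).
  by apply: etrans (fd (to_comp2 v)); rewrite [diff P _ _]comp2_map_to.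
exists (tri_snd_lin G) => u.
have /(congr1 snd) := GP (comp2_val u).
by rewrite /= to_comp2K.
Qed.

End Second.
End TriFunctors.

(** * Exactness of kernels, cokernels, Hom and tensor products along sequences *)
Section Sequences.
Variable R : pzRingType.

Lemma wedge_sequence (C : lmodType R -> Prop) k m (E : nat -> lmodType R)
    (d : forall i, {linear E i.+1 -> E i}) :
  surj (d 0) -> (forall i, exact (d i.+1) (d i)) -> (k <= m)%N ->
  (forall i, (i <= k)%N -> C (E i.+1)) -> (forall i, (k < i)%N -> is_zero (E i.+1)) ->
  wedge C m (E 0).
Proof.
move=> dS dE km Ck E0; exists k; split=> //.
by exists (@resolution_of_sequence _ E d dS dE _ idfun idfun (fun=> erefl) (fun=> erefl)).
Qed.

Lemma vee_sequence (C : lmodType R -> Prop) k m (E : nat -> lmodType R)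
    (d : forall i, {linear E i -> E i.+1}) :
  injective (d 0) -> (forall i, exact (d i) (d i.+1)) -> (k <= m)%N ->
  (forall i, (i <= k)%N -> C (E i.+1)) -> (forall i, (k < i)%N -> is_zero (E i.+1)) ->
  vee C m (E 0).
Proof.
move=> dI dE km Ck E0; exists k; split=> //.
by exists (@Coresolution _ (E 0) (fun i => E i.+1) (fun i => d i.+1) (d 0) dI (dE 0)
  (fun i => dE i.+1)).
Qed.

Definition coaugterm (A : lmodType R) (P : coresolution A) (i : nat) : lmodType R :=
  if i is i'.+1 then coterm P i' else A.

Definition coaugdiff (A : lmodType R) (P : coresolution A) (i : nat) :
    {linear coaugterm P i -> coaugterm P i.+1} :=
  match i with 0 => coaug P | i'.+1 => codiff P i' end.

Lemma coaugdiff_exact (A : lmodType R) (P : coresolution A) i :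
  exact (coaugdiff P i) (coaugdiff P i.+1).
Proof. by case: i => [|i]; [apply: exact_coaug|apply: exact_codiff]. Qed.

Lemma coaugdiff_inj (A : lmodType R) (P : coresolution A) : injective (coaugdiff P 0).
Proof. exact: coaug_inj. Qed.

End Sequences.

(** For a map of exact sequences [A -> B] that is surjective in positive degrees,
    surjectivity in degree zero follows, and the kernels form an exact
    sequence. *)
Section KernelSequence.
Variables (R : pzRingType) (A B : nat -> lmodType R).
Variables (dA : forall i, {linear A i.+1 -> A i}) (dB : forall i, {linear B i.+1 -> B i}).
Variable a : forall i, {linear A i -> B i}.
Hypothesis ad : forall i x, a i (dA i x) = dB i (a i.+1 x).
Hypotheses (dAS : surj (dA 0)) (dAE : forall i, exact (dA i.+1) (dA i)).
Hypotheses (dBS : surj (dB 0)) (dBE : forall i, exact (dB i.+1) (dB i)).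
Hypothesis aS : forall i, surj (a i.+1).

Lemma ker_sequence_surj : surj (a 0).
Proof.
move=> y; have [z <-] := dBS y; have [x <-] := aS z.
by exists (dA 0 x); apply: ad.
Qed.

(** The correction [dA i.+1 w] moves [x] into the kernel of [a i.+1] without
    changing its image. *)
Lemma ker_sequence_lift i x : a i (dA i x) = 0 ->
  exists2 x', dA i x' = dA i x & a i.+1 x' = 0.
Proof.
rewrite ad => /dBE[z]; have [w <-] := aS z => wE.
exists (x - dA i.+1 w); last by rewrite linearB ad wE subrr.
by rewrite linearB (exact_dd dAE) subr0.
Qed.

Fact ker_diff_exists i : exists f : {linear kernel (a i.+1) -> kernel (a i)},
  forall x, ker_incl (a i) (f x) = dA i (ker_incl (a i.+1) x).
Proof.
apply: (factor_inj (f := dA i \o ker_incl (a i.+1)) (@ker_incl_inj _ _ _ (a i))) => z.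
apply/ker_inclP; rewrite /= ad; have /(_ z) -> : forall z, a i.+1 (ker_incl (a i.+1) z) = 0.
  by move=> u; apply/ker_inclP; exists u.
exact: linear0.
Qed.

Lemma ker_sequence : exists d : forall i, {linear kernel (a i.+1) -> kernel (a i)},
  surj (d 0%N) /\ forall i, exact (d i.+1) (d i).
Proof.
exists (fun i => projT1 (cid (ker_diff_exists i))).
pose f i := projT1 (cid (ker_diff_exists i)).
have fP i x : ker_incl (a i) (f i x) = dA i (ker_incl (a i.+1) x).
  exact: (projT2 (cid (ker_diff_exists i))).
have aK i x : a i (ker_incl (a i) x) = 0 by apply/ker_inclP; exists x.
have lift i y : (exists x, dA i x = ker_incl (a i) y) -> exists x, f i x = y.
  move=> [x xE]; have [|x' x'E /ker_inclP[z zE]] := @ker_sequence_lift i x.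
    by rewrite xE aK.
  by exists z; apply: (@ker_incl_inj _ _ _ (a i)); rewrite fP zE x'E.
split=> [y|i y]; first by apply: lift; apply: dAS.
split=> [y0|[x <-]]; last first.
  by apply: (@ker_incl_inj _ _ _ (a i)); rewrite -/(f i) -/(f i.+1) !fP (exact_dd dAE) linear0.
by apply: lift; apply/dAE; rewrite -fP y0 linear0.
Qed.

End KernelSequence.

(** The dual statement, for a map of exact sequences that is injective in positive
    degrees, and the cokernels. *)
Section CokernelSequence.
Variables (R : pzRingType) (A B : nat -> lmodType R).
Variables (dA : forall i, {linear A i -> A i.+1}) (dB : forall i, {linear B i -> B i.+1}).
Variable a : forall i, {linear A i -> B i}.
Hypothesis ad : forall i x, a i.+1 (dA i x) = dB i (a i x).
Hypotheses (dAI : injective (dA 0)) (dAE : forall i, exact (dA i) (dA i.+1)).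
Hypotheses (dBI : injective (dB 0)) (dBE : forall i, exact (dB i) (dB i.+1)).
Hypothesis aI : forall i, injective (a i.+1).

Lemma coker_sequence_inj : injective (a 0).
Proof. by move=> x y xy; apply: dAI; apply: (@aI 0); rewrite !ad xy. Qed.

Let dBdB i x : dB i.+1 (dB i x) = 0.
Proof. by apply/dBE; exists x. Qed.

Lemma coker_sequence_lift i y u : dB i y = a i.+1 u -> exists w, dB i (y - a i w) = 0.
Proof.
move=> yu; have /dAE[w wE] : dA i.+1 u = 0.
  by apply: (@aI i.+1); rewrite ad -yu dBdB linear0.
by exists w; rewrite linearB -ad wE yu subrr.
Qed.

Lemma coker_proj_surj (X Y : lmodType R) (f : {linear X -> Y}) : surj (coker_proj f).
Proof. by elim/coker_ind => y; exists y. Qed.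

Fact coker_diff_exists i : exists f : {linear coker (a i) -> coker (a i.+1)},
  forall y, f (coker_proj (a i) y) = coker_proj (a i.+1) (dB i y).
Proof.
apply: (factor_surj (p := coker_proj (a i)) (f := coker_proj (a i.+1) \o dB i)).
  exact: coker_proj_surj.
move=> y /coker_proj_eq0[x <-] /=; apply/coker_proj_eq0.
by exists (dA i x); apply: ad.
Qed.

Lemma coker_sequence : exists d : forall i, {linear coker (a i) -> coker (a i.+1)},
  injective (d 0%N) /\ forall i, exact (d i) (d i.+1).
Proof.
exists (fun i => projT1 (cid (coker_diff_exists i))).
pose f i := projT1 (cid (coker_diff_exists i)).
have fP i x : f i (coker_proj (a i) x) = coker_proj (a i.+1) (dB i x).
  exact: (projT2 (cid (coker_diff_exists i))).
have lift i y : f i (coker_proj (a i) y) = 0 ->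
    exists2 y', dB i y' = 0 & coker_proj (a i) y' = coker_proj (a i) y.
  rewrite fP => /coker_proj_eq0[u /esym/coker_sequence_lift[w wE]].
  exists (y - a i w) => //; apply/eqP; rewrite -subr_eq0 -linearB; apply/eqP/coker_proj_eq0.
  by exists (- w); rewrite linearN addrAC subrr add0r.
split=> [|i].
  apply: inj_lin; elim/coker_ind=> y /lift[y' y'0 <-].
  by rewrite (_ : y' = 0) ?linear0 //; apply: dBI; rewrite y'0 linear0.
elim/coker_ind=> y; split=> [/lift[y' /dBE[x <-] <-]|[]].
  by exists (coker_proj (a i) x); apply: fP.
elim/coker_ind=> x; rewrite -/(f i) -/(f i.+1) => <-.
by rewrite !fP dBdB linear0.
Qed.

End CokernelSequence.

(** [Hom(N, -)] preserves the exactness of a finite resolution [E] whose terms have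
    vanishing [Ext^j(N, -)] for [1 <= j <= n], provided its length [k] is less
    than [n].  A fixed projective resolution [P] of [N] computes Ext. *)
Section HomExact.
Variables (R : pzRingType) (N : lmodType R) (P : resolution N).
Hypothesis pP : forall i, projective (term P i).

(** Dimension shifting in the second variable: lift the cocycle [c] to [B],
    then correct the lift by a map to [A] so that it becomes a cocycle. *)
Lemma hom_cohomology_shift (A B C : lmodType R) (f : {linear A -> B}) (g : {linear B -> C}) i :
  short_exact f g -> hom_cohomology_zero B P i.+1 -> hom_cohomology_zero A P i.+2 ->
  hom_cohomology_zero C P i.+1.
Proof.
move=> [fI fg gS] HB HA c cd.
have [c' c'P] := @pP _ _ _ g c gS.
have [|a aP] := factor_inj (f := c' \o diff P i.+1) fI.
  by move=> x; apply/fg; rewrite /= c'P cd.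
have [|h hP] := HA a.
  move=> x; apply: fI; rewrite aP /= linear0.
  have -> : diff P i.+1 (diff P i.+2 x) = 0 by apply/exact_diff; exists x.
  exact: linear0.
have [|k kP] := HB (c' \- (f \o h)).
  by move=> x; rewrite /= -hP aP /= subrr.
exists (g \o k) => x; rewrite /= -kP /= linearB c'P.
have /fg -> : exists y, f y = f (h x) by exists (h x).
by rewrite subr0.
Qed.

Lemma hom_lift (A B C : lmodType R) (f : {linear A -> B}) (g : {linear B -> C})
    (c : {linear N -> C}) :
  short_exact f g -> hom_cohomology_zero A P 1 ->
  exists b : {linear N -> B}, forall x, g (b x) = c x.
Proof.
move=> [fI fg gS] HA.
have gf x : g (f x) = 0 by apply/fg; exists x.
have [c' c'P] := @pP _ _ _ g (c \o aug P) gS.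
have augd x : aug P (diff P 0 x) = 0 by apply/exact_aug; exists x.
have [|a aP] := factor_inj (f := c' \o diff P 0) fI.
  by move=> x; apply/fg; rewrite /= c'P /= augd linear0.
have [|h hP] := HA a.
  move=> x; apply: fI; rewrite aP /= linear0.
  have -> : diff P 0 (diff P 1 x) = 0 by apply/exact_diff; exists x.
  exact: linear0.
have [|b bP] := @factor_surj _ _ _ _ _ (c' \- (f \o h)) (@aug_surj _ _ P).
  by move=> x /exact_aug[y <-]; rewrite /= -hP aP /= subrr.
exists b => x; have [y <-] := aug_surj P x.
by rewrite bP /= linearB gf subr0 c'P.
Qed.

Variables (E : nat -> lmodType R) (d : forall i, {linear E i.+1 -> E i}).
Hypotheses (dS : surj (d 0)) (dE : forall i, exact (d i.+1) (d i)).
Variables (k n : nat).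
Hypothesis kn : (k < n)%N.
Hypothesis E0 : forall i, (k < i)%N -> is_zero (E i.+1).
Hypothesis EN : forall i j, (j < n)%N -> hom_cohomology_zero (E i.+1) P j.+1.

(** Descending induction from the end of the sequence: [t] bounds the distance
    from the [i]-th syzygy to the last nonzero one, and each step towards the
    start of the sequence loses one degree of Ext. *)
Lemma hom_cohomology_syzygy t i j : (k <= i + t)%N -> (j + t <= n)%N ->
  hom_cohomology_zero (kernel (d i)) P j.+1.
Proof.
elim: t i j => [|t IH] i j.
  rewrite addn0 => ki _ f _; exists \0 => x.
  apply: (@ker_incl_inj _ _ _ (d i)); rewrite linear0.
  have /dE[y <-] : d i (ker_incl (d i) (f x)) = 0 by apply/ker_inclP; exists (f x).
  by rewrite (E0 (i := i.+1) _ y) ?ltnS // linear0.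
move=> kit jt; have [q qE _] := syzygy_ses dE i.
apply: (hom_cohomology_shift qE); first by apply: EN; apply: leq_trans jt; rewrite addnS leq_addr.
by apply: IH; rewrite ?addSnnS.
Qed.

Lemma hom_sequence_lift (h : {linear N -> E 0}) :
  exists h' : {linear N -> E 1}, forall x, d 0 (h' x) = h x.
Proof.
apply: hom_lift (syzygy0_ses dS) _.
by apply: (hom_cohomology_syzygy (t := k)) => //; rewrite add0n ltnW.
Qed.

Lemma hom_sequence_exact i (h : {linear N -> E i.+1}) : (forall x, d i (h x) = 0) ->
  exists h' : {linear N -> E i.+2}, forall x, d i.+1 (h' x) = h x.
Proof.
move=> hd; have [q qE qP] := syzygy_ses dE i.
have [|h1 h1P] := factor_inj (f := h) (@ker_incl_inj _ _ _ (d i)).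
  by move=> x; apply/ker_inclP.
have [|h' h'P] := hom_lift h1 qE.
  by apply: (hom_cohomology_syzygy (t := k)); rewrite ?leq_addl // add0n ltnW.
by exists h' => x; rewrite -qP h'P h1P.
Qed.

End HomExact.

(** [M (x) -] preserves the exactness of a finite coresolution [E] whose terms have
    vanishing [Tor_j(M, -)] for [1 <= j <= n], provided its length [k] is less
    than [n]. *)
Section TensorExact.
Variables (R S : pzRingType) (M : bimodule R S).
Variables (E : nat -> lmodType S) (d : forall i, {linear E i -> E i.+1}).
Hypotheses (dI : injective (d 0)) (dE : forall i, exact (d i) (d i.+1)).
Variables (k n : nat).
Hypothesis kn : (k < n)%N.
Hypothesis E0 : forall i, (k < i)%N -> is_zero (E i.+1).
Hypothesis EM : forall i j, (j < n)%N -> acyclic (@tens_mono _ _ M) j (E i.+1).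

Lemma cosyzygy_ses i : exists2 q : {linear E i -> kernel (d i.+1)},
  short_exact (ker_incl (d i)) q & forall x, ker_incl (d i.+1) (q x) = d i x.
Proof.
have [|q qP] := factor_inj (f := d i) (@ker_incl_inj _ _ _ (d i.+1)).
  by move=> x; apply/ker_inclP/dE; exists x.
exists q => //; split=> [|y|z]; first exact: ker_incl_inj.
  rewrite -ker_inclP -qP; split=> [->|]; first exact: linear0.
  by move=> q0; apply: (@ker_incl_inj _ _ _ (d i.+1)); rewrite q0 linear0.
have /dE[x xP] : d i.+1 (ker_incl (d i.+1) z) = 0 by apply/ker_inclP; exists z.
by exists x; apply: (@ker_incl_inj _ _ _ (d i.+1)); rewrite qP xP.
Qed.

(** As for Hom: acyclicity of the cosyzygies by descending induction, losing one
    degree in each of at most [k] steps. *)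
Lemma acyclic_cosyzygy t i j : (k < i + t)%N -> (j + t <= n)%N ->
  acyclic (@tens_mono _ _ M) j (kernel (d i.+1)).
Proof.
elim: t i j => [|t IH] i j.
  rewrite addn0 => ki _; apply: acyclic_projective; first exact: tens_mono_class.
  apply: projective_zero => x; apply: (@ker_incl_inj _ _ _ (d i.+1)).
  by rewrite (E0 (i := i) _ (ker_incl _ x)) // linear0.
move=> kit jt; have [q qE _] := cosyzygy_ses i.+1.
apply: (acyclic_shift (tens_mono_class M) qE).
  by apply: EM; apply: leq_trans jt; rewrite addnS leq_addr.
by apply: IH; rewrite ?addSnnS.
Qed.

Let acyclic0 i : acyclic (@tens_mono _ _ M) 0 (kernel (d i.+2)).
Proof.
have ki : (k < i.+1 + k)%N by rewrite addSn ltnS leq_addl.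
exact: (acyclic_cosyzygy ki (ltnW kn : (0 + k <= n)%N)).
Qed.

Let exact_corestr i (q : {linear E i.+1 -> kernel (d i.+2)}) :
  (forall x, ker_incl (d i.+2) (q x) = d i.+1 x) -> exact (d i) q.
Proof.
move=> qP y; rewrite -dE -qP; split=> [->|]; first exact: linear0.
by move=> q0; apply: (@ker_incl_inj _ _ _ (d i.+2)); rewrite q0 linear0.
Qed.

Lemma tens_sequence_inj : injective (tens_map M (d 0)).
Proof.
have [q [_ _ qS] qP] := cosyzygy_ses 1.
by apply: (acyclic0 (v := q)); split=> //; apply: exact_corestr.
Qed.

Lemma tens_sequence_exact i : exact (tens_map M (d i)) (tens_map M (d i.+1)).
Proof.
have [q [_ _ qS] qP] := cosyzygy_ses i.+1.
have [r rE _] := cosyzygy_ses i.+2.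
have inclI : injective (tens_map M (ker_incl (d i.+2))) by apply: acyclic0 rE.
move=> u; rewrite -(tens_right_exact qS (exact_corestr qP)) /=.
have -> : tens_map M (d i.+1) u = tens_map M (ker_incl (d i.+2)) (tens_map M q u).
  by rewrite -tens_map_comp; apply: eq_tens_map => x; rewrite /= qP.
by split=> [|->]; [rewrite -(linear0 (tens_map M (ker_incl (d i.+2)))) => /inclI|rewrite linear0].
Qed.

End TensorExact.

(** * The classes of triples *)
Section KernelIsos.
Variable R : pzRingType.

Lemma kernel_iso (A A' B B' : lmodType R) (a : {linear A -> B}) (a' : {linear A' -> B'})
    (h : {linear A -> A'}) : injective h -> surj h ->
  (forall x, a x = 0 <-> a' (h x) = 0) -> lmod_iso (kernel a) (kernel a').
Proof.
move=> hI hS ha.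
have [|f fP] := factor_inj (f := h \o ker_incl a) (@ker_incl_inj _ _ _ a').
  by move=> z; apply/ker_inclP/ha/ker_inclP; exists z.
apply: (@lmod_iso_of _ _ _ f) => [x y xy|y].
  by apply: (@ker_incl_inj _ _ _ a); apply: hI; have := congr1 (ker_incl a') xy; rewrite !fP.
have [x xE] := hS (ker_incl a' y).
have /ker_inclP[z zE] : a x = 0 by apply/ha; rewrite xE; apply/ker_inclP; exists y.
by exists z; apply: (@ker_incl_inj _ _ _ a'); rewrite fP /= zE.
Qed.

Lemma coker_iso (A A' B B' : lmodType R) (a : {linear A -> B}) (a' : {linear A' -> B'})
    (h : {linear B -> B'}) : surj h ->
  (forall y, (exists x, a x = y) <-> (exists x, a' x = h y)) ->
  lmod_iso (coker a) (coker a').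
Proof.
move=> hS ha.
have [||f fP] := factor_surj (p := coker_proj a) (f := coker_proj a' \o h).
- exact: coker_proj_surj.
- by move=> y /coker_proj_eq0/ha/coker_proj_eq0.
apply: (@lmod_iso_of _ _ _ f).
  apply: inj_lin; elim/coker_ind=> y; rewrite fP => /coker_proj_eq0/ha yE.
  exact/coker_proj_eq0.
elim/coker_ind=> y; have [x <-] := hS y.
by exists (coker_proj a x); apply: fP.
Qed.

Lemma coker_surj (A B : lmodType R) (f : {linear A -> B}) : is_zero (coker f) <-> surj f.
Proof.
split=> [f0 y|fS]; first by apply/coker_proj_eq0/f0.
by elim/coker_ind=> y; apply/coker_proj_eq0.
Qed.

Lemma kernel_inj (A B : lmodType R) (f : {linear A -> B}) : is_zero (kernel f) <-> injective f.
Proof.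
split=> [f0|fI x].
  by apply: inj_lin => x /ker_inclP[u <-]; rewrite (f0 u) linear0.
apply: (@ker_incl_inj _ _ _ f); apply: fI; rewrite !linear0.
by apply/ker_inclP; exists x.
Qed.

End KernelIsos.

Section Hom.
Variables (R S : pzRingType) (M : bimodule R S).

Section HomPost.
Variables (X X' : lmodType R) (f : {linear X -> X'}).

Definition hom_post_fun (g : hom_mod M X) : hom_mod M X' := f \o (g : {linear M -> X}).

Fact hom_post_linear : linear hom_post_fun.
Proof. by move=> s g g'; apply: hom_ext => m; apply: linearD. Qed.

Definition hom_post : {linear hom_mod M X -> hom_mod M X'} := mklin hom_post_linear.

End HomPost.

Lemma hom_ext0 (X : lmodType R) (g : hom_mod M X) : g = 0 <-> forall m, hom_app g m = 0.
Proof. by split=> [-> //|g0]; apply: hom_ext. Qed.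

Lemma adj_eq0 (X : lmodType R) (Y : lmodType S) (phi : {linear tensor M Y -> X}) y :
  adj phi y = 0 <-> forall m, phi (tens m y) = 0.
Proof. exact: hom_ext0. Qed.

Lemma adj_natural (V W : lmodType (tri_ring M)) (f : {linear V -> W}) y :
  adj (comp_phi W) (comp2_map f y) = hom_post (comp1_map f) (adj (comp_phi V) y).
Proof.
apply: hom_ext => m; rewrite -[RHS]/(comp1_map f (comp_phi V (tens m y))).
by rewrite comp_phi_natural tens_map_tens.
Qed.

End Hom.

Section ClassComponents.
Variables (R S : pzRingType) (M : bimodule R S).
Variables (CX CM : lmodType R -> Prop) (CY CN : lmodType S -> Prop).
Hypotheses (CX_class : module_class CX) (CM_class : module_class CM).
Hypotheses (CY_class : module_class CY) (CN_class : module_class CN).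
Implicit Types (V : lmodType (tri_ring M)) (X Z : lmodType R) (Y N : lmodType S).

Lemma module_class_iso (T : pzRingType) (C : lmodType T -> Prop) (A B : lmodType T) :
  module_class C -> lmod_iso A B -> C B -> C A.
Proof. by move=> [_ Ci] /lmod_iso_sym; apply: Ci. Qed.

Lemma iso_components V X Y (phi : {linear tensor M Y -> X}) : lmod_iso V (tri_mod phi) ->
  exists (f : {linear comp1 V -> X}) (g : {linear comp2 V -> Y}),
    [/\ injective f, surj f, injective g, surj g &
        forall u, f (comp_phi V u) = phi (tens_map M g u)].
Proof.
move=> [h hb]; have hI := bij_inj hb.
have hS : surj h by case: hb => k _ hk y; exists (k y).
exists (tri_fst_lin h), (tri_snd_lin h); split; last exact: tri_fst_phi.
- exact: tri_fst_inj.
- exact: tri_fst_surj.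
- exact: tri_snd_inj.
- exact: tri_snd_surj.
Qed.

Lemma class_pair_tri X Y (phi : {linear tensor M Y -> X}) :
  CX X -> CY Y -> class_pair M CX CY (tri_mod phi).
Proof. by move=> cX cY; exists X, Y, phi; split=> //; apply: lmod_iso_refl. Qed.

Lemma class_pair_components V : class_pair M CX CY V -> CX (comp1 V) /\ CY (comp2 V).
Proof.
move=> [X [Y [phi [/iso_components[f [g [fI fS gI gS _]]] cX cY]]]].
by split; [apply: module_class_iso cX|apply: module_class_iso cY] => //;
  [apply: (@lmod_iso_of _ _ _ f)|apply: (@lmod_iso_of _ _ _ g)].
Qed.

Lemma class_D_components V : class_D M CM CN V ->
  [/\ CM (comp1 V), CN (kernel (adj (comp_phi V))) & surj (adj (comp_phi V))].
Proof.
move=> [Z [N [phi [/iso_components[f [g [fI fS gI gS fg]]] cZ cN /coker_surj phiS]]]].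
have fphi m y : f (comp_phi V (tens m y)) = phi (tens m (g y)).
  by rewrite fg tens_map_tens.
split.
- by apply: module_class_iso cZ => //; apply: (@lmod_iso_of _ _ _ f).
- apply: module_class_iso cN => //; apply: (kernel_iso gI gS) => y; rewrite !adj_eq0.
  split=> y0 m; first by rewrite -fphi y0 linear0.
  by apply: fI; rewrite fphi y0 linear0.
- move=> c; have [y' y'E] := phiS (hom_post M f c).
  have [y yE] := gS y'; exists y; apply: hom_ext => m; apply: fI.
  rewrite -[hom_app (adj _ _) _]/(comp_phi V (tens m y)) fphi yE.
  by have := congr1 (fun e => hom_app e m) y'E.
Qed.

Lemma class_B_components V : class_B M CX CY V ->
  [/\ CY (comp2 V), CX (coker (comp_phi V)) & injective (comp_phi V)].
Proof.
move=> [X [Y [phi [/iso_components[f [g [fI fS gI gS fg]]] cY /kernel_inj phiI cX]]]].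
have [g' [g'g gg']] := lmod_iso_inv gI gS.
split.
- by apply: module_class_iso cY => //; apply: (@lmod_iso_of _ _ _ g).
- apply: module_class_iso cX => //; apply: (coker_iso fS) => y; split=> [[x <-]|[x xE]].
    by exists (tens_map M g x).
  by exists (tens_map M g' x); apply: fI; rewrite fg -xE (tens_map_cancel gg').
- move=> x y /(congr1 f); rewrite !fg => /phiI/(congr1 (tens_map M g')).
  by rewrite !(tens_map_cancel g'g).
Qed.

(** A direct decomposition of an [R]-module [B] gives one of [(B, 0)], and the first
    component of a summand of [(B, 0)] is the summand of [B]; likewise for
    [S]-modules and [(0, B)]. *)
Lemma closed_summands_components : closed_summands (class_pair M CX CY) ->
  closed_summands CX /\ closed_summands CY.
Proof.
move=> H; split=> A A' B [h hb] CB.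
  have [[Y0 Y00 CY0] _] := CY_class.
  have fstP := class_pair_tri (\0 : {linear tensor M Y0 -> B}) CB CY0.
  have [||g [gh hg]] := @lmod_iso_inv _ _ _ h; first exact: bij_inj.
    by case: hb => k _ hk y; exists (k y).
  have := H (inc1 M Y0 A) (inc1 M Y0 A') (inc1 M Y0 B).
  case/(_ _ fstP)/class_pair_components => [|CA _]; last first.
    apply: (proj2 CX_class) CA; apply: lmod_iso_sym.
    by apply: lmod_iso_of (inc1_unit_inj (X := A)) (inc1_unit_surj Y00 (X := A)).
  pose k := pair_lin (inc1_map M Y0 (fst \o h)) (inc1_map M Y0 (snd \o h)).
  apply: (@lmod_iso_of _ _ _ k).
    apply: inj_lin => v [v1 _ v2 _]; rewrite [LHS](inc1_eta Y00).
    congr (_, _); rewrite -[LHS]gh -[RHS](linear0 g); congr (g _).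
    by move: v1 v2 => /=; case: (h v.1) => x y /= -> ->.
  move=> [v w]; exists (g (v.1, w.1), 0).
  by rewrite /k /= /tri_map_fun /= !hg [v in RHS](inc1_eta Y00) [w in RHS](inc1_eta Y00).
have [[X0 X00 CX0] _] := CX_class.
have sndP := class_pair_tri (\0 : {linear tensor M B -> X0}) CX0 CB.
have [||g [gh hg]] := @lmod_iso_inv _ _ _ h; first exact: bij_inj.
  by case: hb => k _ hk y; exists (k y).
have := H (inc2 M X0 A) (inc2 M X0 A') (inc2 M X0 B).
case/(_ _ sndP)/class_pair_components => [|_ CA]; last first.
  apply: (proj2 CY_class) CA; apply: lmod_iso_sym.
  by apply: lmod_iso_of (inc2_unit_inj (Y := A)) (inc2_unit_surj X00 (Y := A)).
pose k := pair_lin (inc2_map M X0 (fst \o h)) (inc2_map M X0 (snd \o h)).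
apply: (@lmod_iso_of _ _ _ k).
  apply: inj_lin => v [_ v1 _ v2]; rewrite [LHS](inc2_eta X00).
  congr (_, _); rewrite -[LHS]gh -[RHS](linear0 g); congr (g _).
  by move: v1 v2 => /=; case: (h v.2) => x y /= -> ->.
move=> [v w]; exists (0, g (v.2, w.2)).
by rewrite /k /= /tri_map_fun /= !hg [v in RHS](inc2_eta X00) [w in RHS](inc2_eta X00).
Qed.

(** Along a finite resolution of [V] by modules of the class, the maps [phi^M] form
    a map of exact sequences from the second components to [Hom(M, -)] of the
    first components, which is surjective on every term of the resolution. *)
Lemma class_D_wedge n V : (1 <= n)%N ->
  (forall j, (1 <= j <= n)%N -> forall A, CM A -> Ext_zero j M A) ->
  wedge (class_D M CM CN) n.-1 V ->
  surj (adj (comp_phi V)) /\ wedge CN n.-1 (kernel (adj (comp_phi V))).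
Proof.
move=> n1 extM [k [kn [D [DC D0]]]].
have kn' : (k < n)%N by rewrite -(prednK n1) ltnS.
have [P pP] : exists P : resolution M, forall j, projective (term P j).
  by exists (free_resolution M); apply: free_resolution_projective.
pose W i := augterm D i; pose E i : lmodType R := comp1 (W i).
pose d i : {linear E i.+1 -> E i} := comp1_map (augdiff D i).
have dS : surj (d 0) by apply: comp1_map_surj; apply: augdiff_surj.
have dE i : exact (d i.+1) (d i) by apply: comp1_map_exact; apply: augdiff_exact.
have E0 i : (k < i)%N -> is_zero (E i.+1) by move=> /D0; apply: comp1_zero.
have EN i j : (j < n)%N -> hom_cohomology_zero (E i.+1) P j.+1.
  move=> jn; have [ik|ki] := leqP i k; last first.
    by move=> f _; exists \0 => x; apply: E0.
  by have [cM _ _] := class_D_components (DC i ik); apply: (extM j.+1).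
pose a i : {linear comp2 (W i) -> hom_mod M (E i)} := adj (comp_phi (W i)).
pose dA i : {linear comp2 (W i.+1) -> comp2 (W i)} := comp2_map (augdiff D i).
pose dB i : {linear hom_mod M (E i.+1) -> hom_mod M (E i)} := hom_post M (d i).
have ad i x : a i (dA i x) = dB i (a i.+1 x) by apply: adj_natural.
have dAS : surj (dA 0) by apply: comp2_map_surj; apply: augdiff_surj.
have dAE i : exact (dA i.+1) (dA i) by apply: comp2_map_exact; apply: augdiff_exact.
have dBS : surj (dB 0).
  move=> h; have [h' h'P] := hom_sequence_lift pP dS dE kn' E0 EN h.
  by exists h'; apply: hom_ext.
have dBE i : exact (dB i.+1) (dB i).
  move=> h; split=> [/hom_ext0 h0|[h' <-]]; last first.
    by apply/hom_ext0 => m; apply: exact_dd.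
  have [h' h'P] := hom_sequence_exact pP dE kn' E0 EN (h := h) h0.
  by exists h'; apply: hom_ext.
have aS i : surj (a i.+1).
  have [ik|ki] := leqP i k; first by have [] := class_D_components (DC i ik).
  by move=> h; exists 0; apply: hom_ext => m; rewrite (E0 i ki (hom_app h m)); apply: E0.
split; first exact: (ker_sequence_surj ad dBS aS).
have [dK [dKS dKE]] := ker_sequence ad dAS dAE dBE aS.
apply: (wedge_sequence (E := fun i => kernel (a i)) dKS dKE kn) => i ik.
  by have [] := class_D_components (DC i ik).
move=> x; apply: (@ker_incl_inj _ _ _ (a i.+1)).
by rewrite (comp2_zero (D0 i ik) (ker_incl _ x)) linear0.
Qed.

(** Along a finite coresolution of [V] by modules of the class, the structure maps
    form a map of exact sequences from [M (x) -] of the second components to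
    the first components, which is injective on every term of the
    coresolution. *)
Lemma class_B_vee n V : (1 <= n)%N ->
  (forall j, (1 <= j <= n)%N -> forall B, CY B -> Tor_zero j M B) ->
  vee (class_B M CX CY) n.-1 V ->
  injective (comp_phi V) /\ vee CX n.-1 (coker (comp_phi V)).
Proof.
move=> n1 torM [k [kn [D [DC D0]]]].
have kn' : (k < n)%N by rewrite -(prednK n1) ltnS.
pose W i := coaugterm D i; pose E i : lmodType S := comp2 (W i).
pose d i : {linear E i -> E i.+1} := comp2_map (coaugdiff D i).
have dI : injective (d 0) by apply: comp2_map_inj; apply: coaugdiff_inj.
have dE i : exact (d i) (d i.+1) by apply: comp2_map_exact; apply: coaugdiff_exact.
have E0 i : (k < i)%N -> is_zero (E i.+1) by move=> /D0; apply: comp2_zero.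
have EM i j : (j < n)%N -> acyclic (@tens_mono _ _ M) j (E i.+1).
  move=> jn; have [ik|ki] := leqP i k; last first.
    by apply: acyclic_projective; [apply: tens_mono_class|apply: projective_zero; apply: E0].
  by have [cY _ _] := class_B_components (DC i ik); apply: Tor_zero_acyclic; apply: (torM j.+1).
pose a i : {linear tensor M (E i) -> comp1 (W i)} := comp_phi (W i).
pose dB i : {linear comp1 (W i) -> comp1 (W i.+1)} := comp1_map (coaugdiff D i).
pose dA i : {linear tensor M (E i) -> tensor M (E i.+1)} := tens_map M (d i).
have ad i x : a i.+1 (dA i x) = dB i (a i x) by apply/esym/comp_phi_natural.
have dAI : injective (dA 0) by apply: (tens_sequence_inj dI dE kn' E0 EM).
have dAE i : exact (dA i) (dA i.+1) by apply: (tens_sequence_exact dE kn' E0 EM).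
have dBI : injective (dB 0) by apply: comp1_map_inj; apply: coaugdiff_inj.
have dBE i : exact (dB i) (dB i.+1) by apply: comp1_map_exact; apply: coaugdiff_exact.
have aI i : injective (a i.+1).
  have [ik|ki] := leqP i k; first by have [] := class_B_components (DC i ik).
  apply: inj_lin => u _; rewrite -[LHS]tens_map_id -[RHS](tens_map_0 _ u).
  by apply: eq_tens_map => y; apply: E0.
split; first exact: (@coker_sequence_inj _ _ _ dA dB a ad dAI aI).
have [dK [dKI dKE]] := @coker_sequence _ _ _ dA dB a ad dAE dBI dBE aI.
apply: (vee_sequence (E := fun i => coker (a i)) dKI dKE kn) => i ik.
  by have [] := class_B_components (DC i ik).
elim/coker_ind=> y; rewrite (comp1_zero (D0 i ik) y); exact: linear0.
Qed.

Lemma module_class_zero (T : pzRingType) (C : lmodType T -> Prop) A :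
  module_class C -> is_zero A -> C A.
Proof.
move=> [[Z Z0 CZ] Ci] A0; apply: Ci CZ.
by apply: (@lmod_iso_of _ _ _ \0) => [x y _|y]; [rewrite [x]Z0 [y]Z0|exists 0; rewrite [y]A0].
Qed.

Fact hom_evalDl Z (g : hom_mod M Z) : {morph (hom_app g) : m m' / m + m'}.
Proof. exact: (linearD (g : {linear M -> Z})). Qed.

Fact hom_evalZ Z r m (g : hom_mod M Z) : hom_app g (r *: m) = r *: hom_app g m.
Proof. exact: (linearZZ (g : {linear M -> Z})). Qed.

(** The evaluation [m (x) g |-> g m], whose [phi^M] is the identity. *)
Definition hom_eval Z : {linear tensor M (hom_mod M Z) -> Z} :=
  tlift (b := fun m g => hom_app g m) (@hom_evalDl Z) (fun _ _ _ => erefl)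
    (fun _ _ _ => erefl) (@hom_evalZ Z).

Lemma adj_hom_eval Z g : adj (hom_eval Z) g = g.
Proof.
by apply: hom_ext => m; rewrite -[LHS]/(hom_eval Z (tens m g)) /hom_eval tlift_tens.
Qed.

Lemma class_D_hom Z : CM Z -> class_D M CM CN (tri_mod (hom_eval Z)).
Proof.
move=> cZ; exists Z, (hom_mod M Z), (hom_eval Z); split=> //; first exact: lmod_iso_refl.
- apply: module_class_zero => //; apply/kernel_inj => f g.
  by rewrite /= !adj_hom_eval.
- by apply/coker_surj => g; exists g; apply: adj_hom_eval.
Qed.

Lemma class_D_inc2 X0 N : is_zero X0 -> CM X0 -> CN N -> class_D M CM CN (inc2 M X0 N).
Proof.
move=> X00 cX0 cN; exists X0, N, \0; split=> //; first exact: lmod_iso_refl.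
  apply: module_class_iso cN => //; set a := adj _.
  apply: (@lmod_iso_of _ _ _ (ker_incl a)); first exact: ker_incl_inj.
  by move=> y; apply/ker_inclP/adj_eq0.
by apply/coker_surj => g; exists 0; apply: hom_ext => m; rewrite [LHS]X00 [RHS]X00.
Qed.

Lemma class_B_tensor Y : CY Y ->
  class_B M CX CY (tri_mod (idfun : {linear tensor M Y -> tensor M Y})).
Proof.
move=> cY; exists (tensor M Y), Y, idfun; split=> //; first exact: lmod_iso_refl.
  exact/kernel_inj.
by apply: module_class_zero => //; apply/coker_surj => u; exists u.
Qed.

Lemma tensor_zero Y : is_zero Y -> is_zero (tensor M Y).
Proof.
by move=> Y0 u; rewrite -[LHS]tens_map_id -[RHS](tens_map_0 _ u); apply: eq_tens_map.
Qed.

Lemma class_B_inc1 Y0 X : is_zero Y0 -> CY Y0 -> CX X -> class_B M CX CY (inc1 M Y0 X).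
Proof.
move=> Y00 cY0 cX; exists X, Y0, \0; split=> //; first exact: lmod_iso_refl.
  by apply/kernel_inj => u v _; rewrite (tensor_zero Y00 u) (tensor_zero Y00 v).
apply: (proj2 CX_class) cX; set a := (X in coker X).
apply: (@lmod_iso_of _ _ _ (coker_proj a)); last exact: coker_proj_surj.
by apply: inj_lin => x /coker_proj_eq0[u <-].
Qed.

Lemma wedge_comp1 (C : lmodType (tri_ring M) -> Prop) (C' : lmodType R -> Prop) m V :
  (forall W, C W -> C' (comp1 W)) -> wedge C m V -> wedge C' m (comp1 V).
Proof.
move=> CC' [k [km [D [DC D0]]]].
apply: (wedge_sequence (E := fun i => comp1 (augterm D i))
  (d := fun i => comp1_map (augdiff D i)) _ _ km).
- by apply: comp1_map_surj; apply: augdiff_surj.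
- by move=> i; apply: comp1_map_exact; apply: augdiff_exact.
- by move=> i /DC/CC'.
- by move=> i /D0/comp1_zero.
Qed.

Lemma vee_comp2 (C : lmodType (tri_ring M) -> Prop) (C' : lmodType S -> Prop) m V :
  (forall W, C W -> C' (comp2 W)) -> vee C m V -> vee C' m (comp2 V).
Proof.
move=> CC' [k [km [D [DC D0]]]].
apply: (vee_sequence (E := fun i => comp2 (coaugterm D i))
  (d := fun i => comp2_map (coaugdiff D i)) _ _ km).
- by apply: comp2_map_inj; apply: coaugdiff_inj.
- by move=> i; apply: comp2_map_exact; apply: coaugdiff_exact.
- by move=> i /DC/CC'.
- by move=> i /D0/comp2_zero.
Qed.

End ClassComponents.

(** * Transfer of cotorsion pairs *)
Theorem proposition5p2
    (R S : pzRingType) (M : bimodule R S) (n : nat) (n_ge1 : (1 <= n)%N)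
    (CX CM : lmodType R -> Prop) (CY CN : lmodType S -> Prop)
    (CX_class : module_class CX) (CM_class : module_class CM)
    (CY_class : module_class CY) (CN_class : module_class CN) :
  (left_cotorsion_pair n (class_pair M CX CY) (class_D M CM CN) ->
     ((forall j, (1 <= j <= n)%N -> forall A, CM A -> Ext_zero j M A) ->
        left_cotorsion_pair n CX CM) /\
     ((forall j, (1 <= j <= n)%N -> forall A, CM A -> Ext_zero j M A) ->
      (forall A, CX A -> wedge CN n.-1 (hom_mod M A)) ->
      closed_extensions (wedge CN n.-1) ->
        left_cotorsion_pair n CY CN)) /\
  (right_cotorsion_pair n (class_B M CX CY) (class_pair M CM CN) ->
     ((forall j, (1 <= j <= n)%N -> forall B, CY B -> Tor_zero j M B) ->
        right_cotorsion_pair n CY CN) /\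
     ((forall j, (1 <= j <= n)%N -> forall B, CY B -> Tor_zero j M B) ->
      (forall B, CN B -> vee CX n.-1 (tensor M B)) ->
      closed_extensions (vee CX n.-1) ->
        right_cotorsion_pair n CX CM)).
Proof.
have [[X0 X00 cX0] _] := CX_class; have [[Z0 Z00 cZ0] _] := CM_class.
have [[Y0 Y00 cY0] _] := CY_class; have [[N0 N00 cN0] _] := CN_class.
split=> [[sumL extL preL]|[sumR extR preR]].
- have [sumX sumY] := closed_summands_components CX_class CY_class sumL.
  split=> [_|extM homX clN].
  + split=> // [[|i] // iP X Z cX cZ|A].
      have cX' := class_pair_tri (\0 : {linear tensor M Y0 -> X}) cX cY0.
      have cZ' := class_D_hom M CN_class cZ.
      exact: (Ext_zero_inc1 Y00 (extL _ iP _ _ cX' cZ')).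
    have [K [B [f [g [fg cB wK]]]]] := preL (inc1 M Y0 A).
    have [h [uh hu]] :=
      lmod_iso_inv (inc1_unit_inj (X := A)) (inc1_unit_surj (M := M) Y00 (X := A)).
    exists (comp1 K), (comp1 B), (comp1_map f), (h \o comp1_map g).
    have [cB1 _] := class_pair_components CX_class CY_class cB.
    split=> //; last by apply: wedge_comp1 wK => W /(class_D_components CM_class CN_class)[].
    apply: short_exact_iso_r (comp1_short_exact fg); first exact: can_inj hu.
    by move=> x; exists (inc1_unit M Y0 A x).
  + split=> // [[|i] // iP Y N cY cN|A].
      have cY' := class_pair_tri (\0 : {linear tensor M Y -> X0}) cX0 cY.
      have cN' := class_D_inc2 M CN_class Z00 cZ0 cN.
      have [h [uh hu]] :=
        lmod_iso_inv (inc2_unit_inj (Y := Y)) (inc2_unit_surj (M := M) X00 (Y := Y)).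
      exact: (Ext_zero_comp2 Z00 hu uh (extL _ iP _ _ cY' cN')).
    have [K [B [f [g [fg cB wK]]]]] := preL (inc2 M X0 A).
    have [h [uh hu]] :=
      lmod_iso_inv (inc2_unit_inj (Y := A)) (inc2_unit_surj (M := M) X00 (Y := A)).
    exists (comp2 K), (comp2 B), (comp2_map f), (h \o comp2_map g).
    have [cB1 cB2] := class_pair_components CX_class CY_class cB.
    have [adjS wker] := class_D_wedge CM_class CN_class n_ge1 extM wK.
    split=> //.
      apply: short_exact_iso_r (comp2_short_exact fg); first exact: can_inj hu.
      by move=> x; exists (inc2_unit M X0 A x).
    (* The first components of [K] and [B] agree since that of [(0, A)] is zero. *)
    have cK1 : CX (comp1 K).
      have [fI fgE _] := comp1_short_exact fg.
      apply: module_class_iso cB1 => //; apply: (@lmod_iso_of _ _ _ (comp1_map f)) => // x.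
      by apply/fgE; apply: (comp1_inc2_zero X00).
    apply: (clN _ _ _ (ker_incl (adj (comp_phi K))) (adj (comp_phi K))) wker (homX _ cK1).
    by split=> //; [exact: ker_incl_inj|move=> y; exact: ker_inclP].
- have [sumM sumN] := closed_summands_components CM_class CN_class sumR.
  split=> [_|torM tensN clX].
  + split=> // [[|i] // iP Y N cY cN|A].
      have cY' := class_B_tensor M CX_class cY.
      have cN' := class_pair_tri (\0 : {linear tensor M N -> Z0}) cZ0 cN.
      have [f [g [_ _ gI gS _]]] :=
        iso_components (lmod_iso_refl (tri_mod (idfun : {linear tensor M Y -> tensor M Y}))).
      have [h [hg gh]] := lmod_iso_inv gI gS.
      exact: (Ext_zero_comp2 Z00 hg gh (extR _ iP _ _ cY' cN')).
    have [B [K [f [g [fg cB vK]]]]] := preR (inc2 M Z0 A).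
    exists (comp2 B), (comp2 K), (comp2_map f \o inc2_unit M Z0 A), (comp2_map g).
    have [_ cB2] := class_pair_components CM_class CN_class cB.
    split=> //; last by apply: vee_comp2 vK => W /(class_B_components CX_class CY_class)[].
    apply: short_exact_iso_l (comp2_short_exact fg); first exact: inc2_unit_inj.
    exact: inc2_unit_surj.
  + split=> // [[|i] // iP X Z cX cZ|A].
      have cX' := class_B_inc1 M CX_class Y00 cY0 cX.
      have cZ' := class_pair_tri (\0 : {linear tensor M N0 -> Z}) cZ cN0.
      exact: (Ext_zero_inc1 Y00 (extR _ iP _ _ cX' cZ')).
    have [B [K [f [g [fg cB vK]]]]] := preR (inc1 M N0 A).
    exists (comp1 B), (comp1 K), (comp1_map f \o inc1_unit M N0 A), (comp1_map g).
    have [cB1 cB2] := class_pair_components CM_class CN_class cB.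
    have [phiI vcok] := class_B_vee CX_class CY_class n_ge1 torM vK.
    split=> //.
      apply: short_exact_iso_l (comp1_short_exact fg); first exact: inc1_unit_inj.
      exact: inc1_unit_surj.
    (* The second components of [B] and [K] agree since that of [(A, 0)] is zero. *)
    have cK2 : CN (comp2 K).
      have [_ fgE gS] := comp2_short_exact fg.
      apply: module_class_iso cB2 => //; apply: lmod_iso_sym.
      apply: (@lmod_iso_of _ _ _ (comp2_map g)) => //; apply: inj_lin => x /fgE[y <-].
      by rewrite (comp2_inc1_zero N00 y) linear0.
    apply: (clX _ _ _ (comp_phi K) (coker_proj (comp_phi K))) (tensN _ cK2) vcok.
    split=> //; last exact: coker_proj_surj.
    by move=> y; apply: coker_proj_eq0.
Qed.
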